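(* Let $L$ be an even hyperbolic lattice with fixed positive cone $\mathcal{P}_L$, let $G$ be a subgroup of $\mathrm{O}^+(L)$ of finite index, and let $\mathcal{V}\subset\mathcal{N}_L\cap L^\vee$ satisfy conditions (V1)–(V4) below. Then there exist only finitely many $G$-congruence classes of $\mathcal{V}^*$-chambers. (V1) There is $c>0$ with $-v^2<c$ for all $v\in\mathcal{V}$. (V2) $\mathcal{V}$ is $G$-invariant. (V3) Every $\mathcal{V}^*$-chamber has a finite defining set. (V4) For every $\mathcal{V}^*$-chamber $D$, every non-zero vector $x$ in the closure $\overline{D}$ of $D$ in $L\otimes\mathbb{R}$ with $x^2=0$ is a positive real multiple of a vector of $L$.
   Context: $L$ is an even hyperbolic lattice: a free $\mathbb{Z}$-module of finite rank $n>1$ with a non-degenerate even symmetric bilinear form $\langle\ ,\ \rangle$ of signature $(1,n-1)$, extended to $L\otimes\mathbb{R}$, $x^2=\langle x,x\rangle$. $L^\vee\subset L\otimes\mathbb{Q}$ is the dual lattice. $\mathcal{P}_L$ is one of the two connected components of $\{x: x^2>0\}$; $\mathrm{O}^+(L)$ is the group of isometries of $L$ preserving $\mathcal{P}_L$, acting on the right ($v\mapsto v^g$). $\mathcal{N}_L=\{v\in L\otimes\mathbb{R}: v^2<0\}$; for $v\in\mathcal{N}_L$, $(v)^\perp=\{x\in\mathcal{P}_L:\langle x,v\rangle=0\}$. For $\Delta\subset\mathcal{N}_L$, $\Sigma_L(\Delta)=\{x\in L\otimes\mathbb{R}:\langle x,v\rangle\ge0 \ \forall v\in\Delta\}$. Under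 (V1), the family $\{(v)^\perp: v\in\mathcal{V}\}$ is locally finite in $\mathcal{P}_L$, and a $\mathcal{V}^*$-chamber is the closure in $\mathcal{P}_L$ of a connected component of $\mathcal{P}_L\setminus\bigcup_{v\in\mathcal{V}}(v)^\perp$. A defining set of a $\mathcal{V}^*$-chamber $D$ is a subset $\Delta\subset\mathcal{N}_L\cap L^\vee$ with $D=\Sigma_L(\Delta)\cap\mathcal{P}_L$. Two $\mathcal{V}^*$-chambers $D,D'$ are $G$-congruent if $D'=D^g$ for some $g\in G$. *)

(* Defs.v *)
From HB Require Import structures.
From mathcomp Require Import all_boot all_order all_algebra.
From mathcomp Require Import all_classical all_reals all_analysis.
Set Implicit Arguments. Unset Strict Implicit. Unset Printing Implicit Defensive.
Import Order.TTheory GRing.Theory Num.Theory.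
Import numFieldNormedType.Exports.
Local Open Scope classical_set_scope.
Local Open Scope ring_scope.

(* The lattice L is Z^n (row vectors) with Gram matrix B : 'M[int]_n.
   L (x) R is 'rV[R]_n, and <x,y> = x B y^T. *)
Section Lattice.
Variables (R : realType) (n : nat) (B : 'M[int]_n).

Definition BR : 'M[R]_n := map_mx (fun z : int => z%:~R) B.

Definition bform (x y : 'rV[R]_n) : R := (x *m BR *m y^T) 0 0.
Definition qform (x : 'rV[R]_n) : R := bform x x.

Definition even_hyperbolic : Prop :=
  [/\ (1 < n)%N, B^T = B, (forall i, (2 %| B i i)%Z), \det B != 0 &
     exists P : 'M[R]_n, P \in unitmx /\
       P *m BR *m P^T =
       diag_mx (\row_(i < n) (if val i == 0%N then 1 else -1 : R))].

Definition lattice_pt (x : 'rV[R]_n) : Prop :=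
  exists z : 'rV[int]_n, x = map_mx (fun k : int => k%:~R) z.

Definition dual_pt (x : 'rV[R]_n) : Prop :=
  forall y, lattice_pt y -> exists k : int, bform x y = k%:~R.

Definition positive_cone (P : set 'rV[R]_n) : Prop :=
  exists x0, 0 < qform x0 /\ P = connected_component [set x | 0 < qform x] x0.

Definition negvec (v : 'rV[R]_n) : Prop := qform v < 0.

Definition perp (P : set 'rV[R]_n) (v : 'rV[R]_n) : set 'rV[R]_n :=
  [set x | P x /\ bform x v = 0].

Definition Sigma (Delta : set 'rV[R]_n) : set 'rV[R]_n :=
  [set x | forall v, Delta v -> 0 <= bform x v].

Definition act (g : 'M[int]_n) (x : 'rV[R]_n) : 'rV[R]_n :=
  x *m map_mx (fun k : int => k%:~R) g.

Definition Oplus (P : set 'rV[R]_n) (g : 'M[int]_n) : Prop :=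
  [/\ g \in unitmx, g *m B *m g^T = B & act g @` P `<=` P].

Definition finite_index_subgroup (P : set 'rV[R]_n) (G : set 'M[int]_n) : Prop :=
  [/\ G `<=` Oplus P, G 1%:M,
      (forall g h, G g -> G h -> G (g *m h)),
      (forall g, G g -> G (invmx g)) &
      exists (k : nat) (reps : 'I_k -> 'M[int]_n),
        forall h, Oplus P h -> exists i g, G g /\ h = g *m reps i].

Definition chamber (P V : set 'rV[R]_n) (D : set 'rV[R]_n) : Prop :=
  let U := P `\` \bigcup_(v in V) perp P v in
  exists x0, U x0 /\ D = closure (connected_component U x0) `&` P.

Definition V1 (V : set 'rV[R]_n) : Prop :=
  exists c : R, 0 < c /\ forall v, V v -> - qform v < c.
Definition V2 (G : set 'M[int]_n) (V : set 'rV[R]_n) : Prop :=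
  forall g v, G g -> V v -> V (act g v).
Definition V3 (P V : set 'rV[R]_n) : Prop :=
  forall D, chamber P V D ->
    exists Delta : seq 'rV[R]_n,
      (forall v, v \in Delta -> negvec v /\ dual_pt v) /\
      D = Sigma [set v | v \in Delta] `&` P.
Definition V4 (P V : set 'rV[R]_n) : Prop :=
  forall D, chamber P V D ->
    forall x, closure D x -> x != 0 -> qform x = 0 ->
      exists r : R, exists y, 0 < r /\ lattice_pt y /\ x = r *: y.

End Lattice.

(* Main.v *)
Require Import Defs.
From mathcomp Require Import all_boot all_order all_algebra.
From mathcomp Require Import all_classical all_reals all_analysis.
From mathcomp Require Import perm ring lra zify.
Set Implicit Arguments. Unset Strict Implicit. Unset Printing Implicit Defensive.
Import Order.TTheory GRing.Theory Num.Theory.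
Import numFieldNormedType.Exports.
Local Open Scope classical_set_scope.
Local Open Scope ring_scope.

(* Every point x of the positive cone receives a code from a finite set, so that
   two points with the same code lie in chambers congruent under G. Flipping the
   sign of the form on the orthogonal complement of x gives a positive definite
   form, with respect to which Hermite reduction yields an almost orthogonal
   basis of L, of bounded product of lengths. If no basis vector is very short,
   then the Gram matrix is bounded. Otherwise a single basis vector e is very
   short; it is isotropic and orthogonal to all other basis vectors but one, and
   unipotent changes of basis fixing e make the Gram matrix bounded again. The
   code records the Gram matrix, the position of e, a coset of G, and the sides
   on which x lies of all the walls with small coordinates. If two points have
   the same code, an element of G moves the reduced basis of one to that of the
   other; the conditions of reduction are convex, and a wall containing a reduced
   point has bounded coordinates, so no wall separates the two points.
   (Close to a cusp, walls must contain e: v being in the dual lattice, <v, e> is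
   an integer, and it is small because -v^2 < c.) *)

(** * Bilinear forms given by matrices *)

Section Forms.
Variables (R : comNzRingType) (n : nat).
Implicit Types (A g : 'M[R]_n) (x y z : 'rV[R]_n) (a : R).

Definition form A x y : R := (x *m A *m y^T) 0 0.

Lemma formDl A x y z : form A (x + y) z = form A x z + form A y z.
Proof. by rewrite /form !mulmxDl mxE. Qed.

Lemma formDr A x y z : form A z (x + y) = form A z x + form A z y.
Proof. by rewrite /form linearD /= mulmxDr mxE. Qed.

Lemma formZl A a x z : form A (a *: x) z = a * form A x z.
Proof. by rewrite /form -!scalemxAl mxE. Qed.

Lemma formZr A a x z : form A z (a *: x) = a * form A z x.
Proof. by rewrite /form linearZ /= -scalemxAr mxE. Qed.

Lemma formNl A x z : form A (- x) z = - form A x z.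
Proof. by rewrite -scaleN1r formZl mulN1r. Qed.

Lemma formNr A x z : form A z (- x) = - form A z x.
Proof. by rewrite -scaleN1r formZr mulN1r. Qed.

Lemma formBl A x y z : form A (x - y) z = form A x z - form A y z.
Proof. by rewrite formDl formNl. Qed.

Lemma formBr A x y z : form A z (x - y) = form A z x - form A z y.
Proof. by rewrite formDr formNr. Qed.

Lemma form0l A z : form A 0 z = 0.
Proof. by rewrite /form !mul0mx mxE. Qed.

Lemma form0r A z : form A z 0 = 0.
Proof. by rewrite /form trmx0 mulmx0 mxE. Qed.

Lemma form_tr A x y : form A x y = form A^T y x.
Proof.
by rewrite /form -[in LHS](trmxK (x *m A *m y^T)) mxE !trmx_mul trmxK mulmxA.
Qed.

Lemma formC A x y : A^T = A -> form A x y = form A y x.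
Proof. by move=> sA; rewrite form_tr sA. Qed.

Lemma form_suml A (I : finType) (Q : pred I) (F : I -> 'rV[R]_n) z :
  form A (\sum_(i | Q i) F i) z = \sum_(i | Q i) form A (F i) z.
Proof.
apply: (big_morph (fun x => form A x z)) => [x y|]; first exact: formDl.
exact: form0l.
Qed.

Lemma form_congr A g x y :
  form (g *m A *m g^T) x y = form A (x *m g) (y *m g).
Proof. by rewrite /form trmx_mul !mulmxA. Qed.

Lemma congr_sym A g : A^T = A -> (g *m A *m g^T)^T = g *m A *m g^T.
Proof. by move=> sA; rewrite !trmx_mul trmxK sA mulmxA. Qed.

Lemma form_delta A x j : form A x (delta_mx 0 j) = (x *m A) 0 j.
Proof. by rewrite /form trmx_delta -colE mxE. Qed.

Lemma form_deltal A x i : form A (delta_mx 0 i) x = (x *m A^T) 0 i.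
Proof. by rewrite form_tr form_delta. Qed.

Lemma form_entry A i j : form A (delta_mx 0 i) (delta_mx 0 j) = A i j.
Proof. by rewrite form_delta -rowE mxE. Qed.

Lemma form_coord A x y : form A x y = \sum_i x 0 i * (y *m A^T) 0 i.
Proof.
rewrite {1}[x]row_sum_delta form_suml; apply: eq_bigr => i _.
by rewrite formZl form_deltal.
Qed.

Lemma congr_entry A g i j : (g *m A *m g^T) i j = form A (row i g) (row j g).
Proof. by rewrite -form_entry form_congr -!rowE. Qed.

End Forms.

(** * Positive definite forms and the Cauchy-Schwarz inequality *)

Section PositiveDefinite.
Variables (R : realFieldType) (n : nat).
Implicit Types (A g : 'M[R]_n) (x y : 'rV[R]_n).

Definition posdef A := A^T = A /\ forall x, x != 0 -> 0 < form A x x.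

Lemma posdef_ge0 A x : posdef A -> 0 <= form A x x.
Proof.
case=> _ pA; have [->|/pA/ltW//] := eqVneq x 0; by rewrite form0l.
Qed.

(** With a, b, c the values of the form on (x, x), (x, y), (y, y), the vector c x - b y has square c
    (a c - b^2), which is nonnegative. *)
Lemma posdef_CS A x y : posdef A ->
  form A x y ^+ 2 <= form A x x * form A y y.
Proof.
move=> [sA pA]; have [->|/pA y0] := eqVneq y 0; first by rewrite !form0r expr0n mulr0.
have := posdef_ge0 (form A y y *: x - form A x y *: y) (conj sA pA).
rewrite formBl !formBr !formZl !formZr (formC y x sA).
set a := form A x x; set b := form A x y; set c := form A y y in y0 *.
have -> : c * (c * a) - c * (b * b) - (b * (c * b) - b * (b * c)) =
  c * (a * c - b ^+ 2) by ring.
by rewrite pmulr_rge0 // subr_ge0.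
Qed.

Lemma posdef_congr A g : g \in unitmx -> posdef A -> posdef (g *m A *m g^T).
Proof.
move=> ug [sA pA]; split; first by rewrite !trmx_mul trmxK sA mulmxA.
move=> x x0; rewrite form_congr; apply: pA; apply: contraNneq x0 => xg0.
by rewrite -(mulmxK ug x) xg0 mul0mx.
Qed.

End PositiveDefinite.

(** * Integral matrices viewed over the reals *)

Section IntegerMatrices.
Variable R : realType.

Definition intM m n (g : 'M[int]_(m, n)) : 'M[R]_(m, n) := map_mx intr g.

Lemma intMM m n p (g : 'M[int]_(m, n)) (h : 'M[int]_(n, p)) : intM (g *m h) = intM g *m intM h.
Proof. exact: map_mxM. Qed.

Lemma intM_tr m n (g : 'M[int]_(m, n)) : intM g^T = (intM g)^T.
Proof. by rewrite /intM map_trmx. Qed.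

Lemma intM_inj m n : injective (@intM m n).
Proof.
move=> g h /matrixP gh; apply/matrixP => i j; have := gh i j.
by rewrite !mxE => /eqP; rewrite eqr_int => /eqP.
Qed.

Lemma intM_unit n (g : 'M[int]_n) : g \in unitmx -> intM g \in unitmx.
Proof. by rewrite !unitmxE det_map_mx; apply: rmorph_unit. Qed.

Lemma intM_inv n (g : 'M[int]_n) : g \in unitmx -> intM (invmx g) = invmx (intM g).
Proof.
move=> ug; rewrite -[LHS]mul1mx -(mulVmx (intM_unit ug)) -mulmxA -intMM mulmxV //.
by rewrite /intM map_mx1 mulmx1.
Qed.

Lemma det_unimod_sqr n (g : 'M[int]_n) : g \in unitmx -> \det (intM g) ^+ 2 = 1.
Proof.
rewrite unitmxE det_map_mx => /orP[]/eqP->; first by rewrite expr1n.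
by rewrite rmorphN rmorph1 sqrrN expr1n.
Qed.

Lemma row_intM_neq0 n (g : 'M[int]_n) i : g \in unitmx -> row i g != 0.
Proof.
move=> ug; apply/eqP => r0; have : delta_mx 0 i *m g *m invmx g = 0 :> 'rV[int]_n.
  by rewrite -rowE r0 mul0mx.
by rewrite mulmxK // => /matrixP/(_ 0 i)/eqP; rewrite !mxE !eqxx.
Qed.

Lemma row_intM m n (g : 'M[int]_(m, n)) i : row i (intM g) = intM (row i g).
Proof. by rewrite /intM map_row. Qed.

End IntegerMatrices.

(** * Hermite reduction of positive definite forms *)

Section Hermite.
Variable R : realType.

Lemma posdef_unit n (M : 'M[R]_n) : posdef M -> M \in unitmx.
Proof.
move=> [_ pM]; rewrite unitmxE unitfE; apply/negP => /det0P[v v0 vM].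
by have := pM v v0; rewrite /form vM mul0mx mxE ltxx.
Qed.

(** The dual basis vector [w i] pairs with z to the integer z_i. For z_i nonzero, Cauchy-Schwarz
    gives 1 <= z_i^2 <= M(z, z) M(w_i, w_i), and [K] bounds the last factor for every i. *)
Lemma posdef_min n (M : 'M[R]_n) : posdef M ->
  exists2 a, 0 < a & forall z : 'rV[int]_n, z != 0 -> a <= form M (intM R z) (intM R z).
Proof.
move=> pM; have uM := posdef_unit pM.
pose w i : 'rV[R]_n := delta_mx 0 i *m invmx M.
pose K := 1 + \sum_i form M (w i) (w i).
have K0 : 0 < K by rewrite ltr_pwDl // sumr_ge0 // => i _; exact: posdef_ge0.
exists K^-1; first by rewrite invr_gt0.
move=> z z0; have [i zi] : exists i, z 0 i != 0.
  apply/existsP; apply: contraNT z0; rewrite negb_exists => /forallP zz.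
  by apply/eqP/rowP => i; have := zz i; rewrite negbK mxE => /eqP.
have := posdef_CS (intM R z) (w i) pM.
rewrite {1}/form /w trmx_mul mulmxA trmx_inv pM.1 mulmxK // trmx_delta -colE !mxE.
rewrite -rmorphXn /= => cs.
have z1 : 1 <= (z 0 i ^+ 2)%:~R :> R.
  by rewrite ler1z; move: zi; have := sqr_ge0 (z 0 i); nia.
have wK : form M (w i) (w i) <= K.
  rewrite /K (bigD1 i) //=.
  have : 0 <= \sum_(j | j != i) form M (w j) (w j).
    by rewrite sumr_ge0 // => j _; exact: posdef_ge0.
  lra.
rewrite -[leLHS]mul1r ler_pdivrMr //.
apply: le_trans z1 _; apply: le_trans cs _.
rewrite ler_wpM2l //; exact: posdef_ge0.
Qed.

(** The infimum of the diagonal entry over all bases is positive by [posdef_min], so some basis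
    comes within a factor 2 of it; whether it is attained need not be known. A row swap brings any
    index i to position k. *)
Lemma near_minimal n (M : 'M[R]_n) (k : 'I_n) : posdef M ->
  exists2 g, g \in unitmx & forall h i, h \in unitmx ->
    (intM R g *m M *m (intM R g)^T) k k <= 2 * (intM R h *m M *m (intM R h)^T) i i.
Proof.
move=> pM; have [a a0 am] := posdef_min pM.
pose val (g : 'M[int]_n) i := (intM R g *m M *m (intM R g)^T) i i.
have val_ge g i : g \in unitmx -> a <= val g i.
  by move=> ug; rewrite /val congr_entry row_intM am // row_intM_neq0.
pose S : set R := [set y | exists2 g, g \in unitmx & y = val g k].
have S1 : S (val 1%:M k) by exists 1%:M => //; exact: unitmx1.
have lbS : lbound S a by move=> _ [g ug ->]; exact: val_ge.
have infa : a <= inf S by apply: lb_le_inf => //; exists (val 1%:M k).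
have [|_ [g ug ->] gS] := @inf_adherent _ S (inf S) (lt_le_trans a0 infa).
  by split; [exists (val 1%:M k) | exists a].
exists g => // h i uh; rewrite -/(val _ _) -/(val _ _).
have : inf S <= val h i.
  apply: ge_inf; first by exists a.
  exists (xrow k i h); first by rewrite xrowE unitmx_mul uh andbT unitmx_perm.
  rewrite /val !congr_entry; congr form; apply/rowP => j;
    by rewrite !mxE tpermL.
by move: gS; rewrite -/(val _ _); lra.
Qed.

Lemma posdef_diag n (M : 'M[R]_n) i : posdef M -> 0 < M i i.
Proof.
move=> [_ pM]; rewrite -form_entry; apply: pM.
by apply/eqP => /rowP/(_ i)/eqP; rewrite !mxE !eqxx oner_eq0.
Qed.

Lemma exists_near_int (x : R) : exists t : int, (t%:~R + x) ^+ 2 <= 4^-1.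
Proof.
exists (- Num.floor (x + 2^-1)); have /andP[] := floor_itv (x + 2^-1).
rewrite rmorphN rmorphD rmorph1 /=; set f : R := _%:~R => h1 h2.
have : 0 <= (2^-1 - (- f + x)) * (2^-1 + (- f + x)) by apply: mulr_ge0; lra.
lra.
Qed.

(** The first basis vector, of square a, is split off, its complement is reduced by induction, and
    the other vectors are shifted so that their components along the first are at most 1/2. A new
    diagonal entry d is then at most a/4 + d', with d' its analogue in the complement; as a <= 2 d,
    this gives d <= 2 d', whence the factor 2^n. *)
Lemma hermite_step n (C : R) (M : 'M[R]_(1 + n)) : 0 < C ->
  (forall S : 'M[R]_n, posdef S -> exists2 h, h \in unitmx &
     \prod_i (intM R h *m S *m (intM R h)^T) i i <= C * \det S) ->
  posdef M ->
  (forall h i, h \in unitmx -> M 0 0 <= 2 * (intM R h *m M *m (intM R h)^T) i i) ->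
  exists2 g, g \in unitmx &
    \prod_i (intM R g *m M *m (intM R g)^T) i i <= 2 ^+ n * C * \det M.
Proof.
move=> C0 IH pM nearmin; set a := M 0 0 in nearmin *.
have a0 : 0 < a by exact: posdef_diag.
pose u : 'rV[R]_n := ursubmx M.
have eM : M = block_mx a%:M u u^T (drsubmx M).
  rewrite -[LHS]submxK; congr block_mx.
    by rewrite [LHS]mx11_scalar !mxE; congr (M _ _)%:M; apply: val_inj.
  by rewrite /u trmx_ursub pM.1.
(* [S] is the Schur complement, the Gram matrix of the projections orthogonal to the first vector;
   [MLD] is the resulting block factorization. *)
pose S := drsubmx M - a^-1 *: (u^T *m u).
pose L : 'M[R]_(1 + n) := block_mx 1 0 (a^-1 *: u^T) 1%:M.
pose D : 'M[R]_(1 + n) := block_mx a%:M 0 0 S.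
have dL : \det L = 1 by rewrite det_lblock !det1 mulr1.
have MLD : M = L *m D *m L^T.
  rewrite [LHS]eM /L /D tr_block_mx !mulmx_block !trmx1 !trmx0 linearZ /= trmxK.
  rewrite !(mul0mx, mulmx0, mul1mx, mulmx1, addr0, add0r) mul_scalar_mx mul_mx_scalar.
  rewrite !scalerA mulfV ?lt0r_neq0 // !scale1r -scalemxAr.
  by rewrite addrC subrK.
have uL : L \in unitmx by rewrite unitmxE dL unitr1.
have dM : \det M = a * \det S.
  by rewrite MLD !det_mulmx det_tr dL mul1r mulr1 det_ublock det_scalar1.
have pD : posdef D.
  have -> : D = invmx L *m M *m (invmx L)^T.
    by rewrite MLD -!mulmxA -trmx_mul mulVmx // trmx1 mulmx1 mulmxA mulVmx // mul1mx.
  by apply: posdef_congr => //; rewrite unitmx_inv.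
have pS : posdef S.
  split.
    have /(congr1 drsubmx) := pD.1.
    by rewrite tr_block_mx !block_mxKdr.
  move=> y y0; have := pD.2 (row_mx 0 y).
  rewrite /form /D mul_row_block tr_row_mx mul_row_col.
  rewrite !(mul0mx, mulmx0, addr0, add0r); apply.
  by apply: contraNneq y0 => /eqP; rewrite -row_mx0 => /eqP/eq_row_mx[_ ->].
have [h uh hS] := IH S pS.
(* Adding [t] times the first basis vector rounds the components [s] along it. *)
have [t tP] : exists t : 'cV[int]_n, forall i,
    ((intM R t + intM R h *m (a^-1 *: u^T)) i 0) ^+ 2 <= 4^-1.
  have [f fP] := choice (fun i : 'I_n => exists_near_int ((intM R h *m (a^-1 *: u^T)) i 0)).
  by exists (\col_i f i) => i; have := fP i; rewrite !mxE.
set s := intM R t + _ in tP.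
pose g : 'M[int]_(1 + n) := block_mx 1 0 t h.
have ug : g \in unitmx by rewrite unitmxE det_lblock det1 mul1r -unitmxE.
have gM : intM R g *m M *m (intM R g)^T =
    block_mx a%:M (a *: s^T) (a *: s) (a *: (s *m s^T) + intM R h *m S *m (intM R h)^T).
  have gL : intM R g *m L = block_mx 1 0 s (intM R h).
    rewrite /intM /g map_block_mx map_mx1 map_mx0 mulmx_block.
    by rewrite !(mul0mx, mulmx0, mul1mx, mulmx1, addr0, add0r).
  rewrite MLD !mulmxA gL -mulmxA -trmx_mul gL tr_block_mx !mulmx_block trmx1 trmx0.
  rewrite !(mul0mx, mulmx0, mul1mx, mulmx1, addr0, add0r).
  by rewrite mul_scalar_mx mul_mx_scalar -scalemxAl.
exists g => //.
have step i : 0 <= (intM R g *m M *m (intM R g)^T) (rshift 1 i) (rshift 1 i)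
   <= 2 * (intM R h *m S *m (intM R h)^T) i i.
  have gii : (intM R g *m M *m (intM R g)^T) (rshift 1 i) (rshift 1 i) =
      a * s i 0 ^+ 2 + (intM R h *m S *m (intM R h)^T) i i.
    by rewrite gM block_mxEdr mxE; congr (_ + _); rewrite !mxE big_ord1 !mxE expr2.
  have := nearmin g (rshift 1 i) ug; rewrite gii => h1; have := tP i => h0.
  have h2 : a * s i 0 ^+ 2 <= a * 4^-1 by rewrite ler_wpM2l // ltW.
  by apply/andP; split; lra.
rewrite big_split_ord big_ord1 /= {1}gM block_mxEul mxE eqxx mulr1n.
rewrite [X in _ <= X](_ : _ = a * (2 ^+ n * (C * \det S))); last by rewrite dM; ring.
rewrite ler_wpM2l ?(ltW a0) //.
apply: (@le_trans _ _ (2 ^+ n * \prod_i (intM R h *m S *m (intM R h)^T) i i)); last first.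
  by rewrite ler_wpM2l // exprn_ge0.
have -> : 2 ^+ n = \prod_(i < n) (2 : R) by rewrite prodr_const card_ord.
rewrite -big_split /=; apply: ler_prod => i _; exact: step.
Qed.

(** The induction produces the constant 2^(n(n-1)/2). A unimodular change of basis leaves the
    determinant of the Gram matrix unchanged, so the near-minimal vector may be placed first. *)
Theorem hermite_reduction n : exists2 C : R, 0 < C &
  forall M : 'M[R]_n, posdef M -> exists2 g, g \in unitmx &
    \prod_i (intM R g *m M *m (intM R g)^T) i i <= C * \det M.
Proof.
elim: n => [|n [C C0 IH]].
  exists 1 => // M _; exists 1%:M; first exact: unitmx1.
  by rewrite big_ord0 det_mx00 mulr1.
exists (2 ^+ n * C); first by rewrite mulr_gt0 ?exprn_gt0.
move=> M pM; have [g ug gmin] := near_minimal 0 pM.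
have pgM := posdef_congr (intM_unit R ug) pM.
have comp h : intM R h *m (intM R g *m M *m (intM R g)^T) *m (intM R h)^T =
    intM R (h *m g) *m M *m (intM R (h *m g))^T.
  by rewrite intMM trmx_mul !mulmxA.
have [|h uh hM] := @hermite_step n C _ C0 IH pgM.
  by move=> h i uh; rewrite comp gmin // unitmx_mul uh.
exists (h *m g); first by rewrite unitmx_mul uh.
move: hM; rewrite comp !det_mulmx det_tr.
by rewrite [_ * _ * \det (intM R g)]mulrAC -expr2 det_unimod_sqr // mul1r.
Qed.

End Hermite.

(** * Forms of signature (1, n-1) *)

Section Lorentzian.
Variables (R : realFieldType) (n : nat).
Implicit Types (A : 'M[R]_n) (x y z v w e : 'rV[R]_n).

(** Signature (1, n-1) is stated without a diagonalization, through negativity on the complement of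
    every positive vector. *)
Definition lorentzian A :=
  [/\ A^T = A, exists x, 0 < form A x x &
      forall x v, 0 < form A x x -> form A x v = 0 -> v != 0 -> form A v v < 0].

Lemma form_signature (y z : 'rV[R]_n.+1) :
  form (diag_mx (\row_i (if val i == 0%N then 1 else -1))) y z =
  y 0 0 * z 0 0 - \sum_(i < n) y 0 (lift ord0 i) * z 0 (lift ord0 i).
Proof.
rewrite /form mxE big_ord_recl mul_mx_diag !mxE /= mulr1 -sumrN; congr (_ + _).
by apply: eq_bigr => i _; rewrite !mxE /= mulrN1 mulNr.
Qed.

End Lorentzian.

(** In diagonal coordinates let a and b be the first coordinates of x and v. Then b x - a v has
    first coordinate 0, so its square b^2 q(x) + a^2 q(v) is at most 0. This settles b nonzero; for
    b = 0 the vector v itself lies in the negative part. *)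
Lemma lorentzian_signature (R : realFieldType) (n : nat) (A : 'M[R]_n) (Q : 'M[R]_n) :
  (0 < n)%N -> A^T = A -> Q \in unitmx ->
  Q *m A *m Q^T = diag_mx (\row_i (if val i == 0%N then 1 else -1)) ->
  lorentzian A.
Proof.
case: n A Q => // n A Q _ sA uQ.
set D := diag_mx _ => QD.
have eA x y : form A x y = form D (x *m invmx Q) (y *m invmx Q).
  by rewrite -QD form_congr !mulmxKV.
split=> //.
  exists (delta_mx 0 0 *m Q); rewrite eA mulmxK // form_entry !mxE /= mulr1n; exact: ltr01.
move=> x v; rewrite !eA => qx xv v0.
have : v *m invmx Q != 0 by apply: contraNneq v0 => vQ; rewrite -(mulmxKV uQ v) vQ mul0mx.
move: qx xv; move: (x *m invmx Q) (v *m invmx Q) => {v0}{}x {}v qx xv v0.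
set a := x 0 0; set b := v 0 0.
have sD : D^T = D by rewrite tr_diag_mx.
have qw : form D (b *: x - a *: v) (b *: x - a *: v) = b ^+ 2 * form D x x + a ^+ 2 * form D v v.
  rewrite formBl !formBr !formZl !formZr (formC v x sD) xv; ring.
have qw0 : form D (b *: x - a *: v) (b *: x - a *: v) <= 0.
  rewrite form_signature !mxE -/a -/b [b * a]mulrC subrr mul0r sub0r oppr_le0.
  by rewrite sumr_ge0 // => i _; rewrite -expr2 sqr_ge0.
have a0 : a != 0.
  apply/eqP => a0; move: qx; rewrite form_signature -/a a0 mul0r sub0r oppr_gt0 ltNge.
  by rewrite sumr_ge0 // => i _; rewrite -expr2 sqr_ge0.
have a2 : 0 < a ^+ 2 by rewrite exprn_even_gt0.
have [b0|b0] := eqVneq b 0; last first.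
  have b2 : 0 < b ^+ 2 by rewrite exprn_even_gt0.
  have := mulr_gt0 b2 qx => bq.
  by rewrite -(pmulr_rlt0 _ a2); lra.
have {}v0 : exists i, v 0 (lift ord0 i) != 0.
  apply/existsP; apply: contraNT v0; rewrite negb_exists => /forallP vz.
  apply/eqP/rowP => i; rewrite mxE; case: (unliftP ord0 i) => [j|] ->; last exact: b0.
  by apply/eqP; have := vz j; rewrite negbK.
case: v0 => i vi; rewrite form_signature -/b b0 mul0r sub0r oppr_lt0 (bigD1 i) //=.
rewrite ltr_pwDl //; first by rewrite -expr2 exprn_even_gt0.
by rewrite sumr_ge0 // => j _; rewrite -expr2 sqr_ge0.
Qed.

Lemma lorentzian_congr (R : realFieldType) (n : nat) (A g : 'M[R]_n) :
  g \in unitmx -> lorentzian A -> lorentzian (g *m A *m g^T).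
Proof.
move=> ug [sA [x qx] neg]; split.
- exact: congr_sym.
- by exists (x *m invmx g); rewrite form_congr mulmxKV.
- move=> y v; rewrite !form_congr => qy yv v0; apply: (neg (y *m g)) => //.
  by apply: contraNneq v0 => vg; rewrite -(mulmxK ug v) vg mul0mx.
Qed.

(** * Reverse Cauchy-Schwarz, isotropic vectors and majorants *)

Section LorentzianTheory.
Variables (R : realFieldType) (n : nat) (A : 'M[R]_n).
Hypothesis lA : lorentzian A.
Implicit Types (x y z v w e : 'rV[R]_n).
Local Notation "<[ x , y ]>" := (form A x y).

Let sA : A^T = A. Proof. by case: lA. Qed.

Lemma lorentz_perp_le0 x v : 0 < <[x, x]> -> <[x, v]> = 0 -> <[v, v]> <= 0.
Proof.
move=> qx xv; have [->|v0] := eqVneq v 0; first by rewrite form0l.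
by case: lA => _ _ /(_ x v qx xv v0)/ltW.
Qed.

(** The vector q(x) y - <x, y> x is orthogonal to x, so its square is at most 0. *)
Lemma reverse_CS x y : 0 < <[x, x]> -> <[x, x]> * <[y, y]> <= <[x, y]> ^+ 2.
Proof.
move=> qx; have := @lorentz_perp_le0 x (<[x, x]> *: y - <[x, y]> *: x) qx.
rewrite formBr !formZr => /(_ _)/wrap[]; first by ring.
rewrite formBl !formBr !formZl !formZr (formC y x sA) => h.
by rewrite -subr_le0 -(pmulr_rle0 _ qx); lra.
Qed.

Lemma form_pos_neq0 x y : 0 < <[x, x]> -> 0 < <[y, y]> -> <[x, y]> != 0.
Proof.
move=> qx qy; have := reverse_CS y qx; have := mulr_gt0 qx qy.
by move=> h1 h2; apply/eqP => xy; move: h2; rewrite xy expr0n leNgt h1.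
Qed.

(** The vector <y, z> x - <x, y> z is orthogonal to y; expanding its nonpositive square bounds 2 <x,
    y> <y, z> <x, z> below by a positive number. *)
Lemma form_pos_trans y x z : 0 < <[x, x]> -> 0 < <[y, y]> -> 0 < <[z, z]> ->
  0 < <[x, y]> -> 0 < <[y, z]> -> 0 < <[x, z]>.
Proof.
move=> qx qy qz xy yz.
have := @lorentz_perp_le0 y (<[y, z]> *: x - <[x, y]> *: z) qy.
rewrite formBr !formZr (formC y x sA) => /(_ _)/wrap[]; first by ring.
rewrite formBl !formBr !formZl !formZr (formC z x sA) => h.
have h1 : 0 < <[y, z]> ^+ 2 * <[x, x]> by rewrite mulr_gt0 ?exprn_gt0.
have h2 : 0 < <[x, y]> ^+ 2 * <[z, z]> by rewrite mulr_gt0 ?exprn_gt0.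
by rewrite -(pmulr_rgt0 _ (mulr_gt0 xy yz)); lra.
Qed.

Lemma form_pos_isotropic_neq0 x e : 0 < <[x, x]> -> e != 0 -> <[e, e]> = 0 ->
  <[x, e]> != 0.
Proof.
move=> qx e0 qe; apply/eqP => xe.
by case: lA => _ _ /(_ x e qx xe e0); rewrite qe ltxx.
Qed.

Section IsotropicPerp.
Variable e : 'rV[R]_n.
Hypotheses (e0 : e != 0) (qe : <[e, e]> = 0).

(* Modulo [e], the hyperplane orthogonal to [e] is the one orthogonal to [x]. *)
Let shift x v := v - (<[x, v]> / <[x, e]>) *: e.

Let shift_perp x v : 0 < <[x, x]> -> <[x, shift x v]> = 0.
Proof.
move=> qx; rewrite /shift formBr formZr divfK ?subrr //.
exact: form_pos_isotropic_neq0.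
Qed.

Let form_shift x v w : <[e, v]> = 0 -> <[e, w]> = 0 -> <[shift x v, shift x w]> = <[v, w]>.
Proof.
move=> ev ew; rewrite /shift formBl !formBr !formZl !formZr (formC v e sA) ev ew qe.
ring.
Qed.

(** [shift x v] is orthogonal to a positive x and has the same square as v, because e is isotropic
    and orthogonal to v. *)
Lemma isotropic_perp_le0 v : <[e, v]> = 0 -> <[v, v]> <= 0.
Proof.
move=> ev; case: lA => _ [x qx] _.
by rewrite -(form_shift x) //; apply: (lorentz_perp_le0 qx); exact: shift_perp.
Qed.

Lemma isotropic_perp_parallel v : <[e, v]> = 0 -> <[v, v]> = 0 -> exists a, v = a *: e.
Proof.
move=> ev qv; case: lA => _ [x qx] neg; exists (<[x, v]> / <[x, e]>); apply/eqP.
rewrite -subr_eq0 -/(shift x v); apply/negP => /negP s0.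
by have := neg _ _ qx (shift_perp v qx) s0; rewrite form_shift // qv ltxx.
Qed.

(** The form is negative semidefinite on the complement of e with radical spanned by e; if w lies in
    that radical, both sides vanish. *)
Lemma isotropic_perp_CS v w : <[e, v]> = 0 -> <[e, w]> = 0 ->
  <[v, w]> ^+ 2 <= <[v, v]> * <[w, w]>.
Proof.
move=> ev ew; have := isotropic_perp_le0 ew; rewrite le_eqVlt => /orP[/eqP qw|qw].
  have [a ->] := isotropic_perp_parallel ew qw.
  by rewrite !formZr formZl (formC v e sA) ev qe !mulr0 expr0n.
have := @isotropic_perp_le0 (<[w, w]> *: v - <[v, w]> *: w).
rewrite formBr !formZr ev ew !mulr0 subrr => /(_ erefl).
rewrite formBl !formBr !formZl !formZr (formC w v sA) => h.
by rewrite -subr_ge0 -(nmulr_rle0 _ qw); lra.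
Qed.

End IsotropicPerp.

(* The form is made positive definite by changing its sign on the complement of [x]. *)
Definition majorant x : 'M[R]_n := (2 / <[x, x]>) *: ((x *m A)^T *m (x *m A)) - A.

Lemma form_majorant x y z :
  form (majorant x) y z = 2 * <[x, y]> * <[x, z]> / <[x, x]> - <[y, z]>.
Proof.
rewrite {1}/form /majorant mulmxBr mulmxBl mxE [X in _ + X]mxE -/(form A y z).
congr (_ - _); rewrite -scalemxAr -scalemxAl mxE trmx_mul sA.
rewrite (_ : _ *m z^T = (y *m A *m x^T) *m (x *m A *m z^T)); last by rewrite !mulmxA.
by rewrite mxE big_ord1 -/(form A y x) -/(form A x z) (formC y x sA); ring.
Qed.

Lemma majorant_posdef x : 0 < <[x, x]> -> posdef (majorant x).
Proof.
move=> qx; split.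
  by rewrite /majorant linearB linearZ /= trmx_mul trmxK sA.
move=> y y0; rewrite form_majorant.
have xx0 : <[x, x]> != 0 by rewrite lt0r_neq0.
set a := <[x, y]> / <[x, x]>.
have [yx|v0] := eqVneq y (a *: x).
  have a0 : a != 0 by apply: contraNneq y0 => a0; rewrite yx a0 scale0r.
  rewrite yx !formZl !formZr; set q := <[x, x]> in qx xx0 *.
  have -> : 2 * (a * q) * (a * q) / q - a * (a * q) = a ^+ 2 * q by field.
  by rewrite mulr_gt0 // exprn_even_gt0.
have xv : <[x, y - a *: x]> = 0 by rewrite formBr formZr /a divfK // subrr.
have : <[y - a *: x, y - a *: x]> < 0.
  by case: lA => _ _ /(_ _ _ qx xv); apply; rewrite subr_eq0.
rewrite formBl !formBr !formZl !formZr (formC y x sA) /a.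
set q := <[x, x]> in qx xx0 *; set b := <[x, y]>.
have -> : <[y, y]> - b / q * b - (b / q * b - b / q * (b / q * q)) = <[y, y]> - b ^+ 2 / q by field.
have : 0 <= b ^+ 2 / q by rewrite divr_ge0 ?sqr_ge0 // ltW.
have -> : 2 * b * b / q = 2 * (b ^+ 2 / q) by ring.
lra.
Qed.

(** The map sending y to [w] fixes x and is -1 on its complement. It preserves the majorant, and the
    majorant of w and z is <y, z>, so the Cauchy-Schwarz inequality of the majorant applies. *)
Lemma majorant_CS x y z : 0 < <[x, x]> ->
  <[y, z]> ^+ 2 <= form (majorant x) y y * form (majorant x) z z.
Proof.
move=> qx; have xx0 : <[x, x]> != 0 by rewrite lt0r_neq0.
pose w := (2 * <[x, y]> / <[x, x]>) *: x - y.
have <- : form (majorant x) w w = form (majorant x) y y.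
  rewrite !form_majorant /w !formBr !formBl !formZr !formZl (formC y x sA).
  by field.
have <- : form (majorant x) w z = <[y, z]>.
  by rewrite form_majorant /w !formBr !formBl !formZr !formZl; field.
exact/posdef_CS/majorant_posdef.
Qed.

(** The majorant is [J *m A] for the involution [J] that fixes x and is -1 on its complement, so det
    J has square 1. *)
Lemma det_majorant_sqr x : 0 < <[x, x]> -> \det (majorant x) ^+ 2 = \det A ^+ 2.
Proof.
move=> qx; have xx0 : <[x, x]> != 0 by rewrite lt0r_neq0.
pose N := (A *m x^T) *m x; pose J := (2 / <[x, x]>) *: N - 1%:M.
have NN : N *m N = <[x, x]> *: N.
  rewrite /N -mulmxA [x *m (_ *m _)]mulmxA [x *m (A *m _)]mulmxA.
  rewrite [x *m A *m _]mx11_scalar -/(form A x x) mul_scalar_mx.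
  by rewrite -scalemxAr.
have -> : majorant x = J *m A.
  rewrite /majorant /J mulmxBl mul1mx -scalemxAl /N trmx_mul sA.
  by rewrite !mulmxA.
rewrite det_mulmx exprMn [X in X * _](_ : _ = 1) ?mul1r //.
rewrite expr2 -det_mulmx /J mulmxBr mulmx1 mulmxBl mul1mx -scalemxAl -scalemxAr NN.
rewrite !scalerA [X in X *: N](_ : _ = 2 / <[x, x]> + 2 / <[x, x]>); last by field.
by rewrite scalerDl addrK opprB addrCA subrr addr0 det1.
Qed.

End LorentzianTheory.

(** * Bounded bases and bases with one very short vector *)

Section ReducedBasis.
Variables (R : realType) (n : nat).
Implicit Types (m : 'I_n -> R).

Lemma int_sqr_lt1 (z : int) (a : R) : z%:~R ^+ 2 <= a -> a < 1 -> z = 0.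
Proof.
move=> za a1; have : (z ^+ 2)%:~R < 1%:~R :> R by rewrite rmorphXn /= (le_lt_trans za).
by rewrite ltr_int => h; apply/eqP; apply/negPn/negP => z0; nia.
Qed.

Lemma int_sqr_ge1 (z : int) : z != 0 -> 1 <= z%:~R ^+ 2 :> R.
Proof.
move=> z0; rewrite -rmorphXn /= ler1z; have := sqr_ge0 z; nia.
Qed.

Lemma det_neq0_perm (T : comPzRingType) (A : 'M[T]_n) : \det A != 0 ->
  exists s : 'S_n, forall i, A i (s i) != 0.
Proof.
move=> dA; apply: contrapT => nos; case/eqP: dA; rewrite /determinant big1 // => s _.
have [i] : exists i, A i (s i) == 0.
  apply: contrapT => noi; apply: nos; exists s => i; apply/negP => Ai.
  by apply: noi; exists i.
by move=> /eqP Ai; rewrite (bigD1 i) //= Ai mul0r mulr0.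
Qed.

Lemma prod_ge1 (I : finType) (Q : pred I) (F : I -> R) :
  (forall j, Q j -> 1 <= F j) -> 1 <= \prod_(j | Q j) F j.
Proof.
by move=> F1; elim/big_ind: _ => // x y x1 y1; rewrite mulr_ege1.
Qed.

Lemma le_prod_ge1 (I : finType) (Q : pred I) (F : I -> R) i :
  Q i -> (forall j, Q j -> 1 <= F j) -> F i <= \prod_(j | Q j) F j.
Proof.
move=> Qi F1; rewrite (bigD1 i) //= ler_peMr //; first by apply: le_trans (F1 i Qi).
by apply: prod_ge1 => j /andP[/F1].
Qed.

(** Here [A] is a Gram matrix and [m i] the majorant square of basis vector i. A permutation s with
    nonzero integers A i (s i) gives m i * m (s i) >= 1; these numbers have product at most K^2, so
    each is at most K^2, and lengths bounded below are bounded above. *)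
Lemma gram_dichotomy (A : 'M[int]_n) m (K eps : R) :
  (forall i, 0 < m i) -> (forall i j, (A i j)%:~R ^+ 2 <= m i * m j) ->
  \det A != 0 -> \prod_i m i <= K ->
  (forall i j, i != j -> A i i = 0 -> A i j = 0 -> A j j != 0) ->
  0 < eps < 1 -> eps * K < 1 ->
  (forall i, m i <= K ^+ 2 / eps) \/
  (exists i0 l, [/\ l != i0, forall i, i != l -> A i0 i = 0, m i0 < eps,
     forall i, i != l -> m i <= Num.max K 1 & (A i0 l)%:~R ^+ 2 <= K]).
Proof.
move=> m0 Am dA mK indep /andP[e0 e1] eK.
have [s As] := det_neq0_perm dA.
have ms1 i : 1 <= m i * m (s i) by apply: le_trans (Am _ _); exact: int_sqr_ge1.
have pm0 : 0 < \prod_i m i by apply: prodr_gt0.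
have K0 : 0 < K by exact: lt_le_trans mK.
have msK i : m i * m (s i) <= K ^+ 2.
  apply: le_trans (le_prod_ge1 (Q := predT) (F := fun i => m i * m (s i)) _ _) _ => //.
  have ps : \prod_i m (s i) = \prod_i m i by rewrite [RHS](reindex_inj (@perm_inj _ s)).
  rewrite big_split /= ps -expr2.
  by rewrite ler_sqr ?nnegrE ?(ltW pm0) ?(ltW K0).
have [[i0 mi0]|big] := pselect (exists i0, m i0 < eps); last first.
  left=> i; rewrite ler_pdivlMr //; apply: le_trans (msK i).
  rewrite ler_wpM2l ?(ltW (m0 i)) // leNgt; apply/negP => h.
  by apply: big; exists (s i).
right; pose l := s i0; exists i0, l.
have Ai0 : A i0 i0 = 0.
  apply: (int_sqr_lt1 (Am i0 i0)); have := m0 i0; nra.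
have li0 : l != i0 by apply/eqP => li0; have := As i0; rewrite -/l li0 Ai0.
(* A second vector with majorant square below 1 would be isotropic and orthogonal to vector i0,
   which the independence hypothesis forbids. *)
have m1 i : i != i0 -> 1 <= m i.
  move=> ii0; rewrite leNgt; apply/negP => mi1; have mi := m0 i; have mi0' := m0 i0.
  have h1 : A i i = 0 by apply: (int_sqr_lt1 (Am i i)); nra.
  have h2 : A i0 i = 0 by apply: (int_sqr_lt1 (Am i0 i)); nra.
  by have := indep i0 i; rewrite eq_sym ii0 h1 h2 Ai0 eqxx => /(_ isT erefl erefl).
(* Both m i0 * m l and the product of the remaining factors are at least 1, so each of the two is at
   most K. *)
have prodE : \prod_i m i = (m i0 * m l) * \prod_(j | (j != i0) && (j != l)) m j.
  by rewrite (bigD1 i0) //= (bigD1 l) //= mulrA.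
have rest1 : 1 <= \prod_(j | (j != i0) && (j != l)) m j.
  by apply: prod_ge1 => j /andP[/m1].
have pl1 : 1 <= m i0 * m l by exact: ms1.
have mlK : m i0 * m l <= K by apply: le_trans mK; rewrite prodE ler_peMr // (le_trans _ pl1).
have miK i : i != l -> i != i0 -> m i <= K.
  move=> il ii0; apply: le_trans mK; rewrite prodE.
  apply: (@le_trans _ _ (\prod_(j | (j != i0) && (j != l)) m j)).
    by apply: le_prod_ge1 => [|j /andP[/m1]//]; rewrite ii0.
  by rewrite ler_peMl // (le_trans _ rest1).
split=> //.
- move=> i il; have [->//|ii0] := eqVneq i i0.
  apply: (int_sqr_lt1 (Am i0 i)); apply: le_lt_trans eK.
  by apply: ler_pM; rewrite ?(ltW (m0 _)) ?(ltW mi0) ?miK.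
- move=> i il; rewrite le_max; have [->|ii0] := eqVneq i i0.
    by rewrite (ltW (lt_trans mi0 e1)) orbT.
  by rewrite miK.
- exact: le_trans (Am _ _) mlK.
Qed.

Lemma reduced_basis (B : 'M[int]_n) (eps0 : R) :
  lorentzian (intM R B) -> \det B != 0 -> 0 < eps0 ->
  exists2 K : R, 0 < K & forall x, 0 < form (intM R B) x x ->
  exists2 g, g \in unitmx &
    let A := g *m B *m g^T in
    let m i := (intM R g *m majorant (intM R B) x *m (intM R g)^T) i i in
    (forall i, m i <= K) \/
    (exists i0 l, [/\ l != i0, forall i, i != l -> A i0 i = 0, m i0 < eps0,
       forall i, i != l -> m i <= K & (A i0 l)%:~R ^+ 2 <= K]).
Proof.
move=> lB dB eps00; have [C C0 herm] := hermite_reduction R n.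
(* The majorant has determinant det B up to sign, so this bounds the product of the majorant
   squares; the summand 1 ensures K >= 1. *)
pose K := C * `|\det (intM R B)| + 1.
have K1 : 1 <= K by rewrite lerDr mulr_ge0 // ltW.
have Kp : 0 < K by exact: lt_le_trans ltr01 K1.
(* The second argument makes both eps and eps * K smaller than 1. *)
pose eps := Num.min eps0 (K + 1)^-1.
have ep : 0 < eps by rewrite lt_min eps00 invr_gt0; lra.
have eK : eps * (K + 1) <= 1.
  by rewrite -ler_pdivlMr ?mul1r ?ge_min ?lexx ?orbT //; lra.
exists (Num.max (K ^+ 2 / eps) K); first by rewrite lt_max Kp orbT.
move=> x qx; set M := majorant _ x; have pM : posdef M by exact: majorant_posdef.
have [g ug gM] := herm M pM; exists g => //.
have pgM : posdef (intM R g *m M *m (intM R g)^T).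
  by apply: posdef_congr => //; exact: intM_unit.
have rowAE i j : ((g *m B *m g^T) i j)%:~R = form (intM R B) (row i (intM R g)) (row j (intM R g)).
  by rewrite -congr_entry -intM_tr -!intMM [in RHS]mxE.
cbv zeta.
have [|i j|||i j ij||| all|[i0 [l [li0 Ai0 mi0 mi Al]]]] :=
  @gram_dichotomy (g *m B *m g^T) (fun i => (intM R g *m M *m (intM R g)^T) i i) K eps.
- by move=> i; exact: posdef_diag.
- by rewrite rowAE !congr_entry; apply: majorant_CS.
- rewrite !det_mulmx det_tr !mulf_neq0 //; apply/eqP => d0.
  + by move: ug; rewrite unitmxE d0 unitr0.
  + by move: ug; rewrite unitmxE d0 unitr0.
- apply: le_trans gM _; rewrite ler_wpDr // ler_wpM2l ?(ltW C0) //.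
  apply: le_trans (ler_norm _) _; rewrite -ler_sqr ?nnegrE ?normr_ge0 //.
  by rewrite -!normrX det_majorant_sqr.
(* Two orthogonal isotropic vectors are proportional, which distinct rows of an invertible matrix
   are not. *)
- move=> Aii Aij; apply/eqP => Ajj; have ri0 : row i (intM R g) != 0.
    rewrite row_intM; apply/eqP => r0; have := row_intM_neq0 i ug.
    by rewrite (@intM_inj R _ _ (row i g) 0) ?eqxx // r0 /intM map_mx0.
  have [|||a ra] := @isotropic_perp_parallel _ _ _ lB _ ri0 _ (row j (intM R g)).
  + by rewrite -rowAE Aii.
  + by rewrite -rowAE Aij.
  + by rewrite -rowAE Ajj.
  have : (delta_mx 0 j - a *: delta_mx 0 i : 'rV[R]_n) *m intM R g = 0.
    by rewrite mulmxBl -scalemxAl -!rowE ra subrr.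
  move/(congr1 (mulmx^~ (invmx (intM R g)))); rewrite mulmxK ?intM_unit // mul0mx.
  move/rowP/(_ j)/eqP; rewrite !mxE !eqxx (eq_sym j i) (negPf ij) mulr0 subr0.
  by rewrite oner_eq0.
- rewrite ep /= /eps gt_min invf_lt1; last lra.
  by apply/orP; right; lra.
- have : eps * K < eps * (K + 1) by rewrite ltr_pM2l //; lra.
  lra.
- by left=> i; rewrite le_max all.
- right; exists i0, l; split=> //.
  + by apply: lt_le_trans mi0 _; rewrite /eps ge_min lexx.
  + by move=> i il; rewrite le_max; have := mi i il; rewrite (max_idPl K1) => ->; rewrite orbT.
  + by apply: le_trans Al _; rewrite le_max lexx orbT.
Qed.

End ReducedBasis.

(** * Siegel-type conditions: convexity and walls through reduced points *)

Section Siegel.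
Variables (R : realType) (n : nat).
Implicit Types (A : 'M[R]_n) (x y z u : 'rV[R]_n).

(* The coordinates of a point with respect to a reduced basis, of Gram matrix [A];
   [Some (i0, l)] says that the point lies far in the cusp of the isotropic basis
   vector [i0], and [l] is the only basis vector not orthogonal to it. *)
Definition siegel A (N eps : R) (o : option ('I_n * 'I_n)) x : Prop :=
  match o with
  | None => forall i, (x *m A) 0 i ^+ 2 <= N * form A x x
  | Some (i0, l) =>
      [/\ l != i0, forall i, i != l -> A i0 i = 0,
          (x *m A) 0 i0 ^+ 2 <= eps * form A x x &
          forall i, i != i0 -> `|x 0 i| <= `|x 0 l|]
  end.

(** The cross term is controlled by |a b| <= N (q(x) q(y))^(1/2) <= N <x, y>, the last step being
    the reverse Cauchy-Schwarz inequality. *)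
Lemma sqr_le_form_convex A (N a b s t : R) x y : lorentzian A -> 0 < N ->
  0 < form A x x -> 0 < form A y y -> 0 < form A x y -> 0 <= s -> 0 <= t ->
  a ^+ 2 <= N * form A x x -> b ^+ 2 <= N * form A y y ->
  (s * a + t * b) ^+ 2 <= N * form A (s *: x + t *: y) (s *: x + t *: y).
Proof.
move=> lA N0 qx qy xy s0 t0 ha hb.
have sA : A^T = A by case: lA.
have cs := reverse_CS lA y qx.
rewrite formDl !formDr !formZl !formZr (formC y x sA).
set q := form A x x in qx ha cs *; set q' := form A y y in qy hb cs *.
set c := form A x y in xy cs *.
have ab : a * b <= N * c.
  apply: le_trans (ler_norm _) _; rewrite -ler_sqr ?nnegrE ?normr_ge0 //; last first.
    by rewrite mulr_ge0 // ltW.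
  rewrite -normrX ger0_norm ?sqr_ge0 // !exprMn.
  apply: (@le_trans _ _ ((N * q) * (N * q'))); first by rewrite ler_pM // sqr_ge0.
  have -> : N * q * (N * q') = N ^+ 2 * (q * q') by ring.
  by rewrite ler_wpM2l // sqr_ge0.
have h1 : s ^+ 2 * a ^+ 2 <= s ^+ 2 * (N * q) by rewrite ler_wpM2l // sqr_ge0.
have h2 : t ^+ 2 * b ^+ 2 <= t ^+ 2 * (N * q') by rewrite ler_wpM2l // sqr_ge0.
have h3 : (s * t) * (a * b) <= (s * t) * (N * c) by rewrite ler_wpM2l // mulr_ge0.
lra.
Qed.

(** The vector <y, e> x - <x, e> y is orthogonal to e, so its square is at most 0. Geometrically, e
    or -e lies on the boundary of the cone containing x and y. *)
Lemma isotropic_same_sign A x y e : lorentzian A ->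
  0 < form A x x -> 0 < form A y y -> 0 < form A x y ->
  e != 0 -> form A e e = 0 -> 0 < form A x e * form A y e.
Proof.
move=> lA qx qy xy e0 qe.
have sA : A^T = A by case: lA.
have xe := form_pos_isotropic_neq0 lA qx e0 qe.
have ye := form_pos_isotropic_neq0 lA qy e0 qe.
have := isotropic_perp_le0 lA e0 qe (v := form A y e *: x - form A x e *: y).
rewrite formBr !formZr (formC e x sA) (formC e y sA) => /(_ _)/wrap[]; first by ring.
rewrite formBl !formBr !formZl !formZr (formC y x sA) => h.
have h1 : 0 < form A y e ^+ 2 * form A x x by rewrite mulr_gt0 // exprn_even_gt0.
have h2 : 0 < form A x e ^+ 2 * form A y y by rewrite mulr_gt0 // exprn_even_gt0.
rewrite -(pmulr_rgt0 _ xy); lra.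
Qed.

Lemma delta_mx_neq0 (i : 'I_n) : delta_mx 0 i != 0 :> 'rV[R]_n.
Proof. by apply/eqP => /rowP/(_ i)/eqP; rewrite !mxE !eqxx oner_eq0. Qed.

Lemma mulmx_cusp A (i0 l : 'I_n) x : A^T = A -> (forall i, i != l -> A i0 i = 0) ->
  (x *m A) 0 i0 = x 0 l * A i0 l.
Proof.
move=> sA Ai0; have Aij i j : A i j = A j i by rewrite -[in LHS]sA mxE.
rewrite mxE (bigD1 l) //= big1 ?addr0 => [|i il]; first by rewrite Aij.
by rewrite Aij Ai0 // mulr0.
Qed.

Lemma cusp_coord_neq0 A (i0 l : 'I_n) x : lorentzian A -> 0 < form A x x ->
  l != i0 -> (forall i, i != l -> A i0 i = 0) -> x 0 l * A i0 l != 0.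
Proof.
move=> lA qx li0 Ai0; have sA : A^T = A by case: lA.
have Aii : form A (delta_mx 0 i0) (delta_mx 0 i0) = 0.
  by rewrite form_entry Ai0 // eq_sym.
have := form_pos_isotropic_neq0 lA qx (delta_mx_neq0 i0) Aii.
by rewrite form_delta (mulmx_cusp x sA Ai0).
Qed.

(** In a cusp, the pairings with the isotropic basis vector are x_l and y_l times one constant, so
    x_l and y_l have the same sign. Hence |s x_l + t y_l| = s |x_l| + t |y_l|, and domination by
    coordinate l is inherited. *)
Lemma siegel_convex A (N eps s t : R) o x y : lorentzian A -> 0 < N -> 0 < eps ->
  0 < form A x x -> 0 < form A y y -> 0 < form A x y -> 0 <= s -> 0 <= t ->
  siegel A N eps o x -> siegel A N eps o y -> siegel A N eps o (s *: x + t *: y).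
Proof.
move=> lA N0 eps0 qx qy xy s0 t0; have sA : A^T = A by case: lA.
have coefE i : ((s *: x + t *: y) *m A) 0 i = s * (x *m A) 0 i + t * (y *m A) 0 i.
  by rewrite mulmxDl -!scalemxAl !mxE.
case: o => [[i0 l]|] /= hx hy; last first.
  by move=> i; rewrite coefE; apply: sqr_le_form_convex.
case: hx hy => li0 Ai0 xe xl [_ _ ye yl]; split=> //.
  by rewrite coefE; apply: sqr_le_form_convex.
have Aii : form A (delta_mx 0 i0) (delta_mx 0 i0) = 0.
  by rewrite form_entry Ai0 // eq_sym.
have := isotropic_same_sign lA qx qy xy (delta_mx_neq0 i0) Aii.
rewrite !form_delta !(mulmx_cusp _ sA Ai0) => sgn.
have {}sgn : 0 <= x 0 l * y 0 l.
  have k0 : 0 <= A i0 l ^+ 2 by exact: sqr_ge0.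
  by rewrite leNgt; apply/negP => h; nra.
move=> i ii0; rewrite !mxE; apply: le_trans (ler_normD _ _) _.
rewrite !normrM (ger0_norm s0) (ger0_norm t0).
apply: (@le_trans _ _ (s * `|x 0 l| + t * `|y 0 l|)).
  by rewrite lerD // ler_wpM2l ?xl ?yl.
rewrite -[X in X * `|x 0 l|](ger0_norm s0) -[X in X * `|y 0 l|](ger0_norm t0) -!normrM.
have : 0 <= (s * x 0 l) * (t * y 0 l).
  by rewrite mulrACA mulr_ge0 // mulr_ge0.
move: (s * x 0 l) (t * y 0 l) => a b ab.
case: (ler0P a) => ha; case: (ler0P b) => hb; case: (ler0P (a + b)) => hab; nra.
Qed.

Lemma sqr_le_abs (a b : R) : a ^+ 2 <= b -> `|a| <= b + 1.
Proof.
move=> h; have := sqr_ge0 (`|a| - 1); rewrite sqrrB expr1n mulr1 -normrX ger0_norm ?sqr_ge0 //.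
have := normr_ge0 a; lra.
Qed.

(* Deep in a cusp the wall must contain the isotropic vector, because the
   vector [u] defining it takes integer values on the basis. *)
Lemma siegel_crossing A (c K N eps : R) o z u : lorentzian A ->
  0 < c -> 0 < N -> 0 < eps -> 2 * c * eps < 1 ->
  (forall i j, `|A i j| <= K) -> 0 < form A z z -> siegel A N eps o z ->
  form A z u = 0 -> - form A u u < c ->
  (forall i, exists k : int, (u *m A) 0 i = k%:~R) ->
  forall i, `|(u *m A) 0 i| <= n.+1%:R * (c * (2 * N + K) + 1).
Proof.
move=> lA c0 N0 eps0 ceps AK qz sz zu uc uZ i.
have sA : A^T = A by case: lA.
have qu : form A u u <= 0 by exact: (lorentz_perp_le0 lA qz).
have majE j : form (majorant A z) (delta_mx 0 j) (delta_mx 0 j) =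
    2 * ((z *m A) 0 j ^+ 2 / form A z z) - A j j.
  by rewrite form_majorant // form_delta form_entry expr2 !mulrA.
(* As <z, u> = 0, the majorant of z takes the value -<u, u> < c on u. *)
have bound j : (u *m A) 0 j ^+ 2 <=
    (- form A u u) * (2 * ((z *m A) 0 j ^+ 2 / form A z z) - A j j).
  have := majorant_CS lA u (delta_mx 0 j) qz.
  by rewrite majE form_delta form_majorant // zu mulr0 mul0r sub0r.
have K0 : 0 <= K by apply: le_trans (AK i i); exact: normr_ge0.
have T0 : 0 <= c * (2 * N + K).
  by rewrite mulr_ge0 ?addr_ge0 ?mulr_ge0 ?(ltW c0) ?(ltW N0).
have T1 : 0 <= c * (2 * N + K) + 1 by rewrite addr_ge0.
(* The factor [n.+1] serves the sum of n terms at the end; being at least 1, it does no harm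
   elsewhere. *)
have weak (a : R) : `|a| <= c * (2 * N + K) + 1 ->
    `|a| <= n.+1%:R * (c * (2 * N + K) + 1).
  by move=> h; apply: le_trans h _; rewrite ler_peMl ?ler1n.
case: o sz => [[i0 l]|] sz; last first.
  apply/weak/sqr_le_abs/(le_trans (bound i)).
  apply: ler_pM; rewrite ?oppr_ge0 ?(ltW uc) //.
    by rewrite -majE; exact/posdef_ge0/majorant_posdef.
  have : (z *m A) 0 i ^+ 2 / form A z z <= N by rewrite ler_pdivrMr.
  by have := AK i i; rewrite ler_norml => /andP[h1 _] h2; lra.
case: sz => li0 Ai0 ze zil.
have := cusp_coord_neq0 lA qz li0 Ai0; rewrite mulf_eq0 negb_or => /andP[zl _].
have Aii : A i0 i0 = 0 by rewrite Ai0 // eq_sym.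
(* This coordinate is an integer of square at most 2 c eps < 1. *)
have ui0 : (u *m A) 0 i0 = 0.
  case: (uZ i0) (bound i0) => k -> h; rewrite (@int_sqr_lt1 R k _ h) //.
  have : (z *m A) 0 i0 ^+ 2 / form A z z <= eps by rewrite ler_pdivrMr.
  rewrite Aii subr0; set d := _ / _ => hd.
  have d0 : 0 <= d by rewrite divr_ge0 ?sqr_ge0 // ltW.
  nra.
have e_neq0 := delta_mx_neq0 i0.
have qe : form A (delta_mx 0 i0) (delta_mx 0 i0) = 0 by rewrite form_entry.
(* Semidefiniteness on the complement of e bounds these coordinates through the Gram matrix alone,
   however deep z lies in the cusp. *)
have small j : j != l -> `|(u *m A) 0 j| <= c * (2 * N + K) + 1.
  move=> jl; apply: sqr_le_abs; rewrite -form_delta.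
  have eu : form A (delta_mx 0 i0) u = 0 by rewrite formC // form_delta.
  have ej : form A (delta_mx 0 i0) (delta_mx 0 j) = 0 by rewrite form_entry Ai0.
  apply: le_trans (isotropic_perp_CS lA e_neq0 qe eu ej) _.
  have := isotropic_perp_le0 lA e_neq0 qe ej; rewrite form_entry => Ajj.
  rewrite -mulrNN; apply: ler_pM; rewrite ?oppr_ge0 ?(ltW uc) //.
  have := AK j j; rewrite ler_norml => /andP[h1 _]; lra.
have [->|il] := eqVneq i l; last exact/weak/small.
(* The last coordinate is recovered from <z, u> = 0: coordinate i0 of z, possibly huge, is
   multiplied by 0, and the others are at most |z_l|. *)
have : z 0 l * (u *m A) 0 l = - \sum_(j | j != l) z 0 j * (u *m A) 0 j.
  by apply/eqP; rewrite -addr_eq0; have := form_coord A z u; rewrite zu sA (bigD1 l) //= => <-.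
move/(congr1 Num.norm); rewrite normrM normrN => eq.
rewrite -(ler_pM2l (x := `|z 0 l|)) ?normr_gt0 // eq.
apply: le_trans (ler_norm_sum _ _ _) _.
apply: (@le_trans _ _ (\sum_(j < n) `|z 0 l| * (c * (2 * N + K) + 1))).
  rewrite [leRHS](bigD1 l) //= ler_wpDl ?mulr_ge0 ?T1 //.
  apply: ler_sum => j jl; have [->|ji0] := eqVneq j i0.
    by rewrite ui0 mulr0 normr0 mulr_ge0 ?T1.
  by rewrite normrM ler_pM // ?zil ?small.
rewrite sumr_const card_ord -[_ *+ n]mulr_natl mulrCA ler_wpM2l //.
by rewrite ler_wpM2r ?T1 // ler_nat.
Qed.

End Siegel.

(** * Unipotent changes of basis at a cusp *)

Section Transvections.
Variables (R : realType) (n : nat).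
Implicit Types (A : 'M[int]_n) (x : 'rV[R]_n).

(** When [r *m c = 0] this is unipotent, with inverse obtained by negating r. As a change of basis
    it adds c_i r to basis vector i. *)
Definition transvection (T : comNzRingType) (c : 'cV[T]_n) (r : 'rV[T]_n) : 'M[T]_n :=
  1%:M + c *m r.

Lemma mulmx_transvectionN (T : comNzRingType) (c : 'cV[T]_n) (r : 'rV[T]_n) :
  r *m c = 0 -> transvection c r *m transvection c (- r) = 1%:M.
Proof.
move=> rc; rewrite /transvection mulmxDl mul1mx mulmxDr mulmx1 mulmxN.
rewrite [c *m r *m _]mulmxN [c *m r *m _]mulmxA -[c *m r *m c]mulmxA.
by rewrite rc mulmx0 mul0mx subr0 subrK.
Qed.

Lemma transvection_unit (T : comUnitRingType) (c : 'cV[T]_n) (r : 'rV[T]_n) :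
  r *m c = 0 -> transvection c r \in unitmx.
Proof. by move=> /mulmx_transvectionN/mulmx1_unit[]. Qed.

Lemma mulmx_inv_transvection c r x : r *m c = 0 ->
  x *m invmx (intM R (transvection c r)) = x - (x *m intM R c) *m intM R r.
Proof.
move=> rc; have uT := intM_unit R (transvection_unit rc).
apply: (can_inj (mulmxK uT)); rewrite mulmxKV //.
have rc' : intM R r *m intM R c = 0 by rewrite -intMM rc /intM map_mx0.
have -> : intM R (transvection c r) = 1%:M + intM R c *m intM R r.
  by rewrite /intM /transvection map_mxD map_mx1 map_mxM.
rewrite mulmxDr mulmx1 mulmxBl -[x *m _ *m _ *m (_ *m _)]mulmxA.
by rewrite [_ *m (intM R c *m _)]mulmxA rc' mul0mx mulmx0 subr0 mulmxA subrK.
Qed.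

Lemma row_transvection (T : comNzRingType) (c : 'cV[T]_n) (r : 'rV[T]_n) i :
  row i (transvection c r) = delta_mx 0 i + c i 0 *: r.
Proof.
rewrite /transvection linearD /= row1; congr (_ + _).
by apply/rowP => j; rewrite !mxE big_ord1.
Qed.

Lemma transvection_gram A c r i j : A^T = A ->
  let T := transvection c r in
  (T *m A *m T^T) i j =
    A i j + c j 0 * (r *m A) 0 i + c i 0 * (r *m A) 0 j + c i 0 * c j 0 * form A r r.
Proof.
move=> sA /=; rewrite congr_entry !row_transvection formDl !formDr !formZl !formZr.
rewrite form_entry (formC _ r sA) !form_delta; ring.
Qed.

Section CuspReduction.
Variables (i0 l : 'I_n) (A : 'M[int]_n).
Hypotheses (li0 : l != i0) (sA : A^T = A) (Ai0 : forall i, i != l -> A i0 i = 0).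

(** Adding to basis vector l an integral combination r of the vectors other than i0 and l replaces
    x_i by x_i - x_l r_i, so r_i is the integral part of x_i / x_l. Such an r is orthogonal to
    vector i0, whose pairings therefore persist. *)
Lemma reduce_cusp_point x : x 0 l != 0 ->
  exists2 T, T \in unitmx &
    let A' := T *m A *m T^T in let x' := x *m invmx (intM R T) in
    [/\ forall i, A' i0 i = A i0 i,
        forall i j, i != l -> j != l -> A' i j = A i j,
        x' 0 l = x 0 l &
        forall i, i != i0 -> `|x' 0 i| <= `|x' 0 l|].
Proof.
move=> xl; pose c : 'cV[int]_n := delta_mx l 0.
pose r : 'rV[int]_n :=
  \row_i if (i == i0) || (i == l) then 0 else Num.floor (x 0 i / x 0 l).
have rc : r *m c = 0.
  by rewrite /c -colE; apply/matrixP => i j; rewrite !mxE eqxx orbT.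
exists (transvection c r); first exact: transvection_unit.
have x'E i : (x *m invmx (intM R (transvection c r))) 0 i = x 0 i - x 0 l * (r 0 i)%:~R.
  rewrite mulmx_inv_transvection // !mxE big_ord1 !mxE (bigD1 l) //= big1 ?addr0.
    by rewrite !mxE !eqxx mulr1.
  by move=> k kl; rewrite !mxE (negPf kl) mulr0.
have c0 i : i != l -> c i 0 = 0 by move=> il; rewrite mxE (negPf il).
have rA : (r *m A) 0 i0 = 0.
  rewrite mxE big1 // => k _; have -> : A k i0 = A i0 k by rewrite -[in LHS]sA mxE.
  have [->|kl] := eqVneq k l; first by rewrite mxE eqxx orbT mul0r.
  by rewrite Ai0 // mulr0.
split=> [i|i j il jl||i ii0].
- by rewrite transvection_gram // rA (c0 i0) 1?eq_sym // mulr0 !mul0r !addr0.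
- by rewrite transvection_gram // (c0 i) // (c0 j) // !mul0r !addr0.
- by rewrite x'E mxE eqxx orbT mulr0 subr0.
- rewrite !x'E [r 0 l]mxE eqxx orbT mulr0 subr0.
  have [->|il] := eqVneq i l; first by rewrite mxE eqxx orbT mulr0 subr0.
  rewrite mxE (negPf ii0) (negPf il) /=.
  have /andP[] := floor_itv (x 0 i / x 0 l); set f := Num.floor _.
  rewrite rmorphD rmorph1 /= => h1 h2.
  have -> : x 0 i - x 0 l * f%:~R = x 0 l * (x 0 i / x 0 l - f%:~R) by field.
  by rewrite normrM ler_piMr // ler_norml; apply/andP; split; lra.
Qed.

(** Adding c_j times the isotropic vector i0 to each basis vector j changes A l j by k c_j and A l l
    by 2 k c_l, so row l can be reduced modulo k and 2 k. Of the coordinates of x only the one at i0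
    changes. *)
Lemma reduce_cusp_gram x : A i0 l != 0 ->
  exists2 T, T \in unitmx &
    let A' := T *m A *m T^T in let x' := x *m invmx (intM R T) in
    [/\ forall i, A' i0 i = A i0 i,
        forall i j, i != l -> j != l -> A' i j = A i j,
        forall j, `|A' l j| <= 2 * `|A i0 l| &
        forall i, i != i0 -> x' 0 i = x 0 i].
Proof.
set k := A i0 l => k0.
pose r : 'rV[int]_n := delta_mx 0 i0.
pose c : 'cV[int]_n := \col_j if j == i0 then 0 else
  if j == l then - (A l l %/ (2 * k))%Z else - (A l j %/ k)%Z.
have rc : r *m c = 0.
  by rewrite /r -rowE; apply/matrixP => i j; rewrite !mxE eqxx.
exists (transvection c r); first exact: transvection_unit.
have rA i : (r *m A) 0 i = A i0 i by rewrite /r -rowE mxE.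
have qr : form A r r = 0 by rewrite form_entry Ai0 // eq_sym.
have ci0 : c i0 0 = 0 by rewrite mxE eqxx.
have Ail : A l i0 = k by rewrite -sA mxE.
have gramE i j := transvection_gram c r i j sA.
split=> [i|i j il jl|j|i ii0].
- by rewrite gramE !rA qr ci0 (@Ai0 i0) 1?eq_sym // !mulr0 !mul0r !addr0.
- by rewrite gramE !rA qr (Ai0 il) (Ai0 jl) !mulr0 !addr0.
- rewrite gramE !rA qr -/k mulr0 addr0.
  have k2 : 2 * k != 0 by rewrite mulf_neq0.
  have [->|jl] := eqVneq j l.
    rewrite -/k !mxE (negPf li0) eqxx; have := ltz_mod (A l l) k2; have := modz_ge0 (A l l) k2.
    have := divz_eq (A l l) (2 * k); lia.
  rewrite (Ai0 jl) mulr0 addr0; have [->|ji0] := eqVneq j i0.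
    rewrite ci0 mul0r addr0 Ail; lia.
  rewrite !mxE (negPf ji0) (negPf jl).
  have := ltz_mod (A l j) k0; have := modz_ge0 (A l j) k0.
  have := divz_eq (A l j) k; lia.
- rewrite mulmx_inv_transvection // !mxE big_ord1 !mxE.
  by rewrite (negPf ii0) andbF mulr0 subr0.
Qed.

End CuspReduction.

(** In the bounded case the reduced basis already serves. In a cusp it is improved first for the
    point and then for the Gram matrix; the second change alters only coordinate i0, which the
    domination condition of [siegel] leaves free. *)
Lemma siegel_reduction (B : 'M[int]_n) (eps : R) :
  lorentzian (intM R B) -> \det B != 0 -> 0 < eps ->
  exists K N : R, [/\ 0 < K, 0 < N & forall x, 0 < form (intM R B) x x ->
    exists g o, [/\ g \in unitmx,
      forall i j, `|((g *m B *m g^T) i j)%:~R : R| <= K &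
      siegel (intM R (g *m B *m g^T)) N eps o (x *m invmx (intM R g))]].
Proof.
move=> lB dB eps0; have sBR : (intM R B)^T = intM R B by case: lB.
have sB : B^T = B by apply: (@intM_inj R); rewrite intM_tr.
(* For the isotropic vector i0, [m i0] is twice the ratio that [siegel] compares with eps, hence the
   factor 2. *)
have [|K K0 red] := @reduced_basis R n B (2 * eps) lB dB; first by rewrite mulr_gt0.
exists (2 * K), K; split; rewrite ?mulr_gt0 // => x qx.
have [g ug] := red x qx; set A := g *m B *m g^T; cbv zeta.
set m := fun i => _ i i; rewrite -/(m _).
have sA : A^T = A by exact: congr_sym.
have AR : intM R A = intM R g *m intM R B *m (intM R g)^T by rewrite /A !intMM intM_tr.
set y := x *m invmx (intM R g).
have yg : y *m intM R g = x by rewrite mulmxKV // intM_unit.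
have qy : form (intM R A) y y = form (intM R B) x x by rewrite AR form_congr yg.
have yA i : (y *m intM R A) 0 i = form (intM R B) x (row i (intM R g)).
  by rewrite -form_delta AR form_congr yg rowE.
have mE i : m i = 2 * ((y *m intM R A) 0 i ^+ 2 / form (intM R A) y y) - (A i i)%:~R.
  rewrite /m congr_entry form_majorant // yA qy -congr_entry -AR [intM R A i i]mxE.
  by rewrite expr2 !mulrA.
have m0 i : 0 < m i.
  apply: posdef_diag; apply: posdef_congr (majorant_posdef lB qx); exact: intM_unit.
have Am i j : (A i j)%:~R ^+ 2 <= m i * m j.
  have := majorant_CS lB (row i (intM R g)) (row j (intM R g)) qx.
  by rewrite -!congr_entry -AR [intM R A i j]mxE.
have AK i j : m i <= K -> m j <= K -> `|(A i j)%:~R : R| <= K.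
  move=> mi mj; rewrite -ler_sqr ?nnegrE ?normr_ge0 ?(ltW K0) // -normrX.
  rewrite ger0_norm ?sqr_ge0 //; apply: le_trans (Am i j) _.
  by rewrite expr2 ler_pM // ltW.
have KK : K <= 2 * K by lra.
case=> [mK|[i0 [l [li0 Ai0 mi0 mK kK]]]].
  exists g, None; split=> // [i j|i]; first exact: le_trans (AK i j _ _) KK.
  rewrite -/A -/y -ler_pdivrMr ?qy // -qy; have := AK i i (mK i) (mK i).
  rewrite ler_norml => /andP[_]; have := m0 i; have := Am i i; have := mK i; rewrite mE.
  set a := _%:~R; set d := _ / _ => h1 h2 h3 h4.
  (* Here m i = 2 d - a; since |a| <= m i, it follows that d <= m i <= K. *)
  have : a <= 2 * d - a by nra.
  lra.
have lA : lorentzian (intM R A) by rewrite AR; apply: lorentzian_congr => //; exact: intM_unit.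
have ARi0 i : i != l -> intM R A i0 i = 0 by move=> il; rewrite mxE Ai0.
have := @cusp_coord_neq0 R n _ _ _ y lA _ li0 ARi0; rewrite qy => /(_ qx).
rewrite mulf_eq0 negb_or [intM R A i0 l]mxE intr_eq0 => /andP[yl k0].
have [T1 uT1 /=[A1i0 A1ij y1l y1i]] := reduce_cusp_point li0 sA Ai0 yl.
set A1 := T1 *m A *m T1^T in A1i0 A1ij; set y1 := y *m _ in y1l y1i.
have sA1 : A1^T = A1 by exact: congr_sym.
have A1z i : i != l -> A1 i0 i = 0 by move=> il; rewrite A1i0 Ai0.
have k1 : A1 i0 l != 0 by rewrite A1i0.
have [T2 uT2 /=[A2i0 A2ij A2l y2i]] := reduce_cusp_gram li0 sA1 A1z y1 k1.
have uTT : T2 *m T1 \in unitmx by rewrite unitmx_mul uT2.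
exists (T2 *m T1 *m g), (Some (i0, l)).
have -> : T2 *m T1 *m g *m B *m (T2 *m T1 *m g)^T = T2 *m A1 *m T2^T.
  by rewrite /A1 /A !trmx_mul !mulmxA.
have -> : x *m invmx (intM R (T2 *m T1 *m g)) = y1 *m invmx (intM R T2).
  have uTTg : T2 *m T1 *m g \in unitmx by rewrite unitmx_mul uTT.
  apply: (can_inj (mulmxK (intM_unit R uTTg))); rewrite mulmxKV ?intM_unit //.
  by rewrite !intMM !mulmxA mulmxKV ?intM_unit // mulmxKV ?intM_unit // yg.
set A2 := T2 *m A1 *m T2^T in A2i0 A2ij A2l *; set y2 := y1 *m _ in y2i *.
have sA2 : A2^T = A2 by exact: congr_sym.
have qy2 : form (intM R A2) y2 y2 = form (intM R A) y y.
  rewrite /A2 /A1 !intMM !intM_tr !form_congr /y2 mulmxKV ?intM_unit //.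
  by rewrite /y1 mulmxKV ?intM_unit.
have A2R i : i != l -> intM R A2 i0 i = 0 by move=> il; rewrite mxE A2i0 A1z.
split; first by rewrite unitmx_mul uTT.
(* Row l is bounded by 2 |k| with k = A i0 l, and the integer k satisfies |k| <= k^2 <= K. *)
- have Alj j : `|(A2 l j)%:~R : R| <= 2 * K.
    rewrite -intr_norm; apply: (@le_trans _ _ (2 * `|A1 i0 l|)%:~R); first by rewrite ler_int.
    rewrite rmorphM /= A1i0 ler_wpM2l //; apply: le_trans kK.
    by rewrite -rmorphXn /= ler_int; nia.
  move=> i j; have [->|il] := eqVneq i l; first exact: Alj.
  have [->|jl] := eqVneq j l; first by rewrite -sA2 mxE Alj.
  by rewrite A2ij // A1ij //; apply: le_trans KK; apply: AK; exact: mK.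
- have sA2R : (intM R A2)^T = intM R A2 by rewrite -intM_tr sA2.
  have sAR : (intM R A)^T = intM R A by rewrite -intM_tr sA.
  split=> //.
    rewrite (mulmx_cusp y2 sA2R A2R) [intM R A2 i0 l]mxE A2i0 A1i0 y2i // y1l qy2 qy.
    have -> : y 0 l * (A i0 l)%:~R = (y *m intM R A) 0 i0.
      by rewrite (mulmx_cusp y sAR ARi0) [intM R A i0 l]mxE.
    rewrite -ler_pdivrMr // -qy; have : m i0 < 2 * eps by exact: mi0.
    rewrite mE Ai0 1?eq_sym // subr0; lra.
  by move=> i ii0; rewrite !y2i // y1i.
Qed.

End Transvections.

(** * Continuity of linear maps and connected components *)

Section Continuity.
Variables (R : realType) (n : nat).

Lemma row_linear_continuous (V : normedModType R) (w : 'I_n -> V) :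
  continuous (fun x : 'rV[R]_n => \sum_i x 0 i *: w i).
Proof.
apply: continuous_big => [|i _ x]; first exact: add_continuous.
by apply: continuousZr_tmp; exact: coord_continuous.
Qed.

Lemma form_continuous (A : 'M[R]_n) y : continuous (fun x => form A x y).
Proof.
have -> : (fun x => form A x y) = (fun x : 'rV[R]_n => \sum_i x 0 i *: ((y *m A^T) 0 i : R^o)).
  by apply/funext => x; rewrite form_coord.
exact: row_linear_continuous.
Qed.

Lemma act_continuous (g : 'M[int]_n) : continuous (@act R n g).
Proof.
have -> : @act R n g = (fun x : 'rV[R]_n => \sum_i x 0 i *: row i (intM R g)).
  by apply/funext => x; rewrite /act mulmx_sum_row.
exact: row_linear_continuous.
Qed.

Lemma segment_component (E : set 'rV[R]_n) x y :
  (forall t : R, 0 <= t <= 1 -> E ((1 - t) *: x + t *: y)) -> connected_component E x y.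
Proof.
move=> sE; pose f (t : R) := (1 - t) *: x + t *: y.
have cf : continuous f.
  move=> t; apply: cvgD; apply: cvgZr_tmp; last exact: cvg_id.
  by apply: cvgB; [exact: cvg_cst | exact: cvg_id].
exists (f @` `[0, 1]); last first.
  by exists 1; rewrite /= ?in_itv /= ?ler01 ?lexx // /f subrr scale0r add0r scale1r.
split.
- by exists 0; rewrite /= ?in_itv /= ?ler01 ?lexx // /f subr0 scale0r addr0 scale1r.
- by move=> _ [t /= t01 <-]; apply: sE; move: t01; rewrite in_itv.
- apply: connected_continuous_connected; first exact: segment_connected.
  by apply: continuous_subspaceT.
Qed.

Lemma closure_image (T T' : topologicalType) (f : T -> T') (E : set T) x :
  continuous f -> closure E x -> closure (f @` E) (f x).
Proof.
move=> cf Ex W /cf /Ex[y [Ey fy]]; exists (f y); split=> //; by exists y.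
Qed.

Lemma component_image (T T' : topologicalType) (f : T -> T') (E : set T) (E' : set T') x y :
  continuous f -> f @` E `<=` E' -> connected_component E x y ->
  connected_component E' (f x) (f y).
Proof.
move=> cf EE' [C [Cx CE cC] Cy]; exists (f @` C); last by exists y.
split; first by exists x.
- by move=> _ [z Cz <-]; apply: EE'; exists z => //; exact: CE.
- by apply: connected_continuous_connected => //; exact: continuous_subspaceT.
Qed.

End Continuity.

(** * The positive cone and its isometries *)

Section PositiveCone.
Variables (R : realType) (n : nat) (B : 'M[int]_n) (P : set 'rV[R]_n).
Hypotheses (lB : lorentzian (intM R B)) (posP : positive_cone B P).
Local Notation form := (form (intM R B)).

Let sB : (intM R B)^T = intM R B. Proof. by case: lB. Qed.

(** Pairing with x maps a connected set of positive vectors onto an interval, and the interval omits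
    0 because two positive vectors are never orthogonal. *)
Lemma positive_cone_gt0 x y : P x -> P y -> 0 < form x y.
Proof.
case: posP => x0 [qx0 ->] Px Py.
have {}Py : connected_component [set x | 0 < qform B x] x y.
  by apply: connected_component_trans Py; apply: connected_component_sym.
have qx : 0 < form x x by exact: connected_component_sub Px.
case: Py => C [Cx CE cC] Cy.
have icC : is_interval ((fun z => form z x) @` C).
  apply/connected_intervalP/connected_continuous_connected => //.
  by apply: continuous_subspaceT => z; exact: form_continuous.
rewrite formC // ltNge; apply/negP => yx.
have iy : ((fun z => form z x) @` C) (form y x) by exists y.
have ix : ((fun z => form z x) @` C) (form x x) by exists x.
have [|z Cz /eqP] := icC _ _ iy ix 0; first by rewrite yx ltW.
by apply/negP; apply: form_pos_neq0 => //; exact: CE.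
Qed.

Lemma positive_coneP x y : P x -> P y <-> 0 < form y y /\ 0 < form x y.
Proof.
move=> Px; split=> [Py|[qy xy]]; first by split; exact: positive_cone_gt0.
have qx := positive_cone_gt0 Px Px.
case: posP Px => x0 [qx0 ->] Px; apply: connected_component_trans Px _.
apply: segment_component => t /andP[t0 t1] /=.
rewrite /qform -[bform _ _ _]/(form _ _) formDl !formDr !formZl !formZr (formC y x) //.
have s0 : 0 <= 1 - t by lra.
have [->|tn] := eqVneq t 0; first by rewrite subr0 !mul0r !mul1r !addr0.
have tp : 0 < t by rewrite lt0r tn.
have a1 := mulr_ge0 s0 (mulr_ge0 s0 (ltW qx)).
have a2 := mulr_ge0 s0 (mulr_ge0 (ltW tp) (ltW xy)).
have a3 := mulr_gt0 tp (mulr_gt0 tp qy).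
lra.
Qed.

Definition isometry (h : 'M[int]_n) := h \in unitmx /\ h *m B *m h^T = B.

Lemma isometry_form h x y : isometry h -> form (act h x) (act h y) = form x y.
Proof.
case=> uh hB; rewrite -[in RHS]hB !intMM intM_tr form_congr.
by [].
Qed.

Lemma isometryN h : isometry h -> isometry (- h).
Proof.
case=> uh hB; split; first by rewrite -scaleN1r unitmxZ.
by rewrite linearN /= !mulNmx mulmxN opprK.
Qed.

(** The sign is that of <x0, x0^h> for one x0 in the cone; [form_pos_trans] carries it over to the
    whole cone. *)
Lemma isometry_sign h : isometry h -> exists b : bool, Oplus B P ((-1) ^+ b *: h).
Proof.
move=> hB; have [x0 Px0] : exists x0, P x0.
  by case: posP => x0 [qx0 ->]; exists x0; exact: connected_component_refl.
have q0 := positive_cone_gt0 Px0 Px0.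
have key k : isometry k -> 0 < form x0 (act k x0) -> Oplus B P k.
  move=> kB k0; case: (kB) => uk eB; split=> // _ [y Py <-].
  have qy := positive_cone_gt0 Py Py.
  apply/(positive_coneP _ Px0); split; first by rewrite isometry_form.
  apply: (form_pos_trans lB (y := act k x0)) => //; rewrite isometry_form //.
  exact: positive_cone_gt0.
have : form x0 (act h x0) != 0 by apply: form_pos_neq0; rewrite ?isometry_form.
case: (ltrgtP 0 (form x0 (act h x0))) => // h0 _.
  by exists false; rewrite scale1r; exact: key.
exists true; rewrite expr1 scaleN1r; apply: key; first exact: isometryN.
rewrite /act -/(intM R _) (_ : intM R (- h) = - intM R h) ?mulmxN; last first.
  by rewrite /intM map_mxN.
by rewrite formNr oppr_gt0.
Qed.

End PositiveCone.

(** * Finite codes for matrices and for cosets *)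

Section Codes.

(** One object is chosen for each code that occurs. Codes form a relation, so an object may have
    several. *)
Lemma finite_transversal (S : Type) (T : finType) (X : S -> Prop)
    (c : S -> T -> Prop) (E : S -> S -> Prop) :
  (forall D, X D -> exists t, c D t) ->
  (forall D D' t, X D -> X D' -> c D t -> c D' t -> E D D') ->
  exists (k : nat) (Ds : 'I_k -> S),
    (forall i, X (Ds i)) /\ forall D, X D -> exists i, E (Ds i) D.
Proof.
move=> cX cE; pose L := [seq t <- enum T | `[< exists D, X D /\ c D t >]].
have memL t : (t \in L) = `[< exists D, X D /\ c D t >] by rewrite mem_filter mem_enum andbT.
have exD (i : 'I_(size L)) : exists D, X D /\ c D (tnth (in_tuple L) i).
  by apply/asboolP; rewrite -memL; exact: mem_tnth.
have [Ds DsP] := choice exD.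
exists (size L), Ds; split=> [i|D XD]; first by case: (DsP i).
have [t cDt] := cX D XD.
have : t \in in_tuple L by rewrite memL; apply/asboolP; exists D.
case/tnthP => i ti; exists i; have [XDs cDs] := DsP i.
by apply: (cE _ _ t) => //; rewrite ti.
Qed.

(** The interval [-M, M] is shifted to [0, 2M] to become a finite type; integers outside it are not
    represented faithfully. *)
Definition box (M : nat) (z : int) : 'I_(M + M).+1 := inord `|z + M%:Z|.
Definition unbox (M : nat) (j : 'I_(M + M).+1) : int := j%:Z - M%:Z.

Lemma boxK (M : nat) (z : int) : `|z| <= M%:Z -> unbox (box M z) = z.
Proof. by move=> zM; rewrite /unbox /box inordK; lia. Qed.

Variables (R : realType) (n : nat) (B : 'M[int]_n) (P : set 'rV[R]_n) (G : set 'M[int]_n).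
Hypotheses (lB : lorentzian (intM R B)) (posP : positive_cone B P)
  (finG : finite_index_subgroup B P G).

(** The code is a sign placing h in [Oplus] together with the index of a coset representative. For
    equal codes the signs and the representatives cancel in [h *m invmx h']. *)
Lemma coset_code : exists (T : finType) (code : 'M[int]_n -> T -> Prop),
  (forall h, isometry B h -> exists t, code h t) /\
  forall h h' t, isometry B h' -> code h t -> code h' t -> G (h *m invmx h').
Proof.
case: finG => GO G1 GM GV [k [reps repsP]].
exists (bool * 'I_k)%type,
  (fun (h : 'M[int]_n) (t : bool * 'I_k) =>
     exists g, G g /\ (-1) ^+ t.1 *: h = g *m reps t.2); split.
  move=> h hB; have [b hO] := isometry_sign lB posP hB.
  by have [i [g [Gg e]]] := repsP _ hO; exists (b, i), g.
move=> h h' [b i] [uh' _] /= [g [Gg e]] [g' [Gg' e']].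
have ug' : g' \in unitmx by case: (GO _ Gg').
suff -> : h *m invmx h' = g *m invmx g' by apply: GM => //; exact: GV.
have sgn (m : 'M[int]_n) : (-1) ^+ b *: ((-1) ^+ b *: m) = m.
  by rewrite scalerA -signr_addb addbb scale1r.
have -> : h = (g *m invmx g') *m h'.
  rewrite -[h]sgn e -[in RHS](sgn h') e' -scalemxAr -mulmxA.
  by rewrite [invmx g' *m _]mulmxA mulVmx // mul1mx.
by rewrite mulmxK.
Qed.

End Codes.

(** * Chambers containing a given point off the walls, and the action of G *)

Section Chambers.
Variables (R : realType) (n : nat) (B : 'M[int]_n).
Variables (P : set 'rV[R]_n) (G : set 'M[int]_n) (V : set 'rV[R]_n).
Hypotheses (lB : lorentzian (intM R B)) (posP : positive_cone B P)
  (finG : finite_index_subgroup B P G) (GV : V2 G V).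
Local Notation form := (form (intM R B)).

Definition wall_complement := P `\` \bigcup_(v in V) perp B P v.
Local Notation U := wall_complement.
Definition chamber_at x := closure (connected_component U x) `&` P.

Lemma wall_complementP x : U x <-> P x /\ forall v, V v -> form x v != 0.
Proof.
split=> [[Px nx]|[Px nx]]; split=> //.
  by move=> v Vv; apply/eqP => xv; apply: nx; exists v.
by case=> v Vv [_ /eqP]; apply/negP/nx.
Qed.

Lemma group_isometry g : G g -> isometry B g.
Proof. by case: finG => GO _ _ _ _ /GO[]. Qed.

Lemma actKV g (x : 'rV[R]_n) : G g -> act g (act (invmx g) x) = x.
Proof.
move=> Gg; have [ug _] := group_isometry Gg.
by rewrite /act -/(intM R _) -/(intM R g) intM_inv // mulmxKV // intM_unit.
Qed.

Lemma group_inv g : G g -> G (invmx g).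
Proof. by case: finG => _ _ _ GI _; exact: GI. Qed.

Lemma wall_complement_act g x : G g -> U x -> U (act g x).
Proof.
move=> Gg /wall_complementP[Px nx]; apply/wall_complementP; split.
  by case: finG => GO _ _ _ _; case: (GO _ Gg) => _ _; apply; exists x.
move=> v Vv; rewrite -(actKV v Gg) isometry_form; last exact: group_isometry.
by apply/nx/GV => //; exact: group_inv.
Qed.

Lemma chamber_at_act_sub g x : G g -> act g @` chamber_at x `<=` chamber_at (act g x).
Proof.
move=> Gg _ [y [cy Py] <-]; split; last first.
  by case: finG => GO _ _ _ _; case: (GO _ Gg) => _ _; apply; exists y.
have := closure_image (@act_continuous R n g) cy; apply: closureS => _ [z xz <-].
apply: component_image xz; first exact: act_continuous.
by move=> _ [w Uw <-]; exact: wall_complement_act.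
Qed.

Lemma chamber_at_act g x : G g -> act g @` chamber_at x = chamber_at (act g x).
Proof.
move=> Gg; apply/seteqP; split; first exact: chamber_at_act_sub.
move=> y cy; exists (act (invmx g) y); last exact: actKV.
have := chamber_at_act_sub (group_inv Gg) (x := act g x).
have [ug _] := group_isometry Gg.
have -> : act (invmx g) (act g x) = x.
  by rewrite /act -/(intM R g) -/(intM R (invmx g)) intM_inv // mulmxK // intM_unit.
by apply; exists y.
Qed.

Lemma chamber_at_segment x y :
  (forall t : R, 0 <= t <= 1 -> U ((1 - t) *: x + t *: y)) -> chamber_at x = chamber_at y.
Proof.
by move=> /segment_component xy; rewrite /chamber_at (same_connected_component xy).
Qed.

End Chambers.

(** * Separation by walls and finiteness of the classes *)

Lemma even_hyperbolic_lorentzian (R : realType) n (B : 'M[int]_n) :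
  even_hyperbolic R B -> lorentzian (intM R B) /\ \det B != 0.
Proof.
case=> n1 sB _ dB [Q [uQ QB]]; split=> //; apply: lorentzian_signature QB => //.
  exact: ltnW.
by rewrite -intM_tr sB.
Qed.

Lemma same_sign_combo (R : realType) (a b t : R) :
  a != 0 -> b != 0 -> (0 < a) = (0 < b) -> 0 <= t <= 1 -> (1 - t) * a + t * b != 0.
Proof.
move=> a0 b0 ab /andP[t0 t1]; apply/eqP => e.
move: ab; case: (ltrgtP 0 a) a0 => // ha _; case: (ltrgtP 0 b) b0 => // hb _ _.
  have h1 : 0 <= (1 - t) * a by rewrite mulr_ge0 ?subr_ge0 // ltW.
  have h2 : 0 <= t * b by rewrite mulr_ge0 // ltW.
  have [h3 h4] : (1 - t) * a = 0 /\ t * b = 0 by split; lra.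
  by move/eqP: h4; rewrite mulf_eq0 (gt_eqF hb) orbF => /eqP t00; move: h3; rewrite t00; lra.
have h1 : (1 - t) * a <= 0 by rewrite mulr_ge0_le0 ?subr_ge0 // ltW.
have h2 : t * b <= 0 by rewrite mulr_ge0_le0 // ltW.
have [h3 h4] : (1 - t) * a = 0 /\ t * b = 0 by split; lra.
by move/eqP: h4; rewrite mulf_eq0 (lt_eqF hb) orbF => /eqP t00; move: h3; rewrite t00; lra.
Qed.

Lemma exists_nat_bound (R : realType) (K : R) :
  exists M : nat, forall z : int, `|z%:~R : R| <= K -> `|z| <= M%:Z.
Proof.
exists (Num.bound `|K|) => z zK.
have : `|z|%:~R < (Num.bound `|K|)%:Z%:~R :> R.
  rewrite intr_norm; apply: le_lt_trans zK _; apply: le_lt_trans (ler_norm K) _.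
  exact: archi_boundP.
by rewrite ltr_int => /ltW.
Qed.

(* Along the segment between two points with the same code, no
   wall can be crossed, since a wall doing so has bounded coordinates and hence
   its side is recorded in the code. *)
Lemma segment_in_complement (R : realType) n (B : 'M[int]_n) (P : set 'rV[R]_n)
    (V : set 'rV[R]_n) (c K N eps : R) (M : nat) (g : 'M[int]_n) o (y y' : 'rV[R]_n) :
  lorentzian (intM R B) -> positive_cone B P ->
  (forall v, V v -> dual_pt B v) -> (forall v, V v -> - qform B v < c) ->
  0 < c -> 0 < N -> 0 < eps -> 2 * c * eps < 1 ->
  (forall z : int, `|z%:~R : R| <= n.+1%:R * (c * (2 * N + K) + 1) -> `|z| <= M%:Z) ->
  g \in unitmx -> (forall i j, `|((g *m B *m g^T) i j)%:~R : R| <= K) ->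
  siegel (intM R (g *m B *m g^T)) N eps o y -> siegel (intM R (g *m B *m g^T)) N eps o y' ->
  wall_complement B P V (y *m intM R g) -> wall_complement B P V (y' *m intM R g) ->
  (forall w : 'rV[int]_n, (forall i, `|w 0 i| <= M%:Z) ->
     (0 < \sum_i y 0 i * (w 0 i)%:~R) = (0 < \sum_i y' 0 i * (w 0 i)%:~R)) ->
  forall t : R, 0 <= t <= 1 ->
    wall_complement B P V ((1 - t) *: (y *m intM R g) + t *: (y' *m intM R g)).
Proof.
move=> lB posP Vd Vc c0 N0 eps0 ceps MP ug AK sy sy' /wall_complementP[Py ny]
  /wall_complementP[Py' ny'] same t t01.
set x := y *m intM R g in Py ny *; set x' := y' *m intM R g in Py' ny' *.
set A := g *m B *m g^T in AK sy sy'.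
have AR : intM R A = intM R g *m intM R B *m (intM R g)^T by rewrite /A !intMM intM_tr.
have uR := intM_unit R ug.
have lA : lorentzian (intM R A) by rewrite AR; exact: lorentzian_congr.
have [s0 t0] : 0 <= 1 - t /\ 0 <= t by case/andP: t01 => t0 t1; rewrite subr_ge0.
have xx := positive_cone_gt0 lB posP Py Py.
have xx' := positive_cone_gt0 lB posP Py Py'.
have x'x' := positive_cone_gt0 lB posP Py' Py'.
have Pz : P ((1 - t) *: x + t *: x').
  apply/(positive_coneP lB posP _ Py).
  have sB : (intM R B)^T = intM R B by case: lB.
  rewrite !formDr !formDl !formZr !formZl (formC x' x sB).
  have t10 : t = 0 \/ 0 < t by case: (ltrgtP 0 t) t0 => // [? _|<- _]; [right|left].
  case: t10 => [->|tp].
    by rewrite !subr0 !mul0r !mul1r !addr0.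
  have a1 := mulr_ge0 s0 (mulr_ge0 s0 (ltW xx)).
  have a2 := mulr_ge0 s0 (mulr_ge0 t0 (ltW xx')).
  have a3 := mulr_gt0 tp (mulr_gt0 tp x'x').
  have a4 := mulr_ge0 s0 (ltW xx).
  have a5 := mulr_gt0 tp xx'.
  by split; lra.
apply/wall_complementP; split=> // v Vv.
pose u := v *m invmx (intM R g).
have ug' : u *m intM R g = v by rewrite mulmxKV.
have formA a b : form (intM R A) a b = form (intM R B) (a *m intM R g) (b *m intM R g).
  by rewrite AR form_congr.
(* A wall vector lies in the dual lattice and pairs integrally with the basis; the integers [w]
   determine its side at any point. *)
have [w wP] : exists w : 'rV[int]_n, forall i, (u *m intM R A) 0 i = (w 0 i)%:~R.
  have exk i : exists k : int, (u *m intM R A) 0 i = k%:~R.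
    have [|k kP] := Vd v Vv (row i (intM R g)); first by exists (row i g); rewrite row_intM.
    exists k; rewrite -kP -form_delta formA ug' -rowE.
    by rewrite -[bform _ _ _]/(form (intM R B) _ _).
  have [f fP] := choice exk.
  by exists (\row_i f i) => i; rewrite mxE.
have sA : (intM R A)^T = intM R A by case: lA.
have sumE a : form (intM R A) a u = \sum_i a 0 i * (w 0 i)%:~R.
  by rewrite form_coord sA; apply: eq_bigr => i _; rewrite wP.
apply/negP => /eqP zv.
pose z := (1 - t) *: y + t *: y'.
have zE : z *m intM R g = (1 - t) *: x + t *: x' by rewrite mulmxDl -!scalemxAl.
have sz : siegel (intM R A) N eps o z.
  by apply: siegel_convex; rewrite ?formA.
have wM i : `|w 0 i| <= M%:Z.
  apply: MP; rewrite -wP; apply: (siegel_crossing (o := o) (z := z) (eps := eps)) => //.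
  - by move=> j k; rewrite mxE.
  - by rewrite formA zE; exact: (positive_cone_gt0 lB posP Pz Pz).
  - by rewrite formA zE ug'.
  - by rewrite formA ug'; exact: Vc.
  - by move=> j; exists (w 0 j).
have := same w wM; rewrite -!sumE !formA ug' -/x -/x' => sgn.
have := same_sign_combo (ny v Vv) (ny' v Vv) sgn t01.
by rewrite -[(1 - t) * _]formZl -[t * _]formZl -formDl zv eqxx.
Qed.

Theorem theorem3p7 (R : realType) (n : nat) (B : 'M[int]_n)
  (P : set 'rV[R]_n) (G : set 'M[int]_n) (V : set 'rV[R]_n) :
  even_hyperbolic R B ->
  positive_cone B P ->
  finite_index_subgroup B P G ->
  (forall v, V v -> negvec B v /\ dual_pt B v) ->
  V1 B V -> V2 G V -> V3 B P V -> V4 B P V ->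
  exists (k : nat) (Ds : 'I_k -> set 'rV[R]_n),
    (forall i, chamber B P V (Ds i)) /\
    forall D, chamber B P V D ->
      exists i g, G g /\ D = act g @` Ds i.
Proof.
move=> /even_hyperbolic_lorentzian[lB dB] posP finG Vd [c [c0 Vc]] GV _ _.
have Vd' v : V v -> dual_pt B v by case/Vd.
(* With this value 2 c eps = 1/2, below the least nonzero square of an integer. *)
pose eps : R := (4 * c)^-1.
have eps0 : 0 < eps by rewrite invr_gt0 mulr_gt0.
have ceps : 2 * c * eps < 1.
  have -> : 2 * c * eps = 2^-1 by rewrite /eps; field; rewrite gt_eqF.
  lra.
have [K [N [K0 N0 red]]] := siegel_reduction lB dB eps0.
have [M1 M1P] := exists_nat_bound K.
have [M2 M2P] := exists_nat_bound (n.+1%:R * (c * (2 * N + K) + 1)).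
have [T [code [codeE codeG]]] := coset_code lB posP finG.
(* One reference basis is fixed for each Gram matrix A that occurs; the value 0 is a default for the
   other matrices. Comparing a basis g with [ref] yields an isometry, to which [coset_code]
   applies. *)
have exref (A : 'M[int]_n) : exists r : 'M[int]_n,
    (exists2 g, g \in unitmx & g *m B *m g^T = A) -> r \in unitmx /\ r *m B *m r^T = A.
  have [[g ug gA]|no] := pselect (exists2 g, g \in unitmx & g *m B *m g^T = A).
    by exists g.
  by exists 0 => /no.
have [ref refP] := choice exref.
have isoref g : g \in unitmx -> isometry B (invmx g *m ref (g *m B *m g^T)).
  move=> ug; have [|ur rA] := refP (g *m B *m g^T); first by exists g.
  split; first by rewrite unitmx_mul unitmx_inv ug.
  rewrite trmx_mul !mulmxA -[X in X *m _]mulmxA -[X in X *m _]mulmxA [ref _ *m (B *m _)]mulmxA rA.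
  by rewrite -!mulmxA -trmx_mul mulVmx // trmx1 mulmx1 mulmxA mulVmx // mul1mx.
(* Each [w] encodes the pairings of a potential wall with the basis; the set collects those positive
   at the point with coordinates y. *)
pose sides (y : 'rV[R]_n) := [set w : 'rV['I_(M2 + M2).+1]_n |
  0 < \sum_i y 0 i * (unbox (w 0 i))%:~R]%SET.
pose cell := ('M['I_(M1 + M1).+1]_n * option ('I_n * 'I_n) * T *
              {set 'rV['I_(M2 + M2).+1]_n})%type.
pose U := wall_complement B P V.
pose coded (D : set 'rV[R]_n) (t : cell) := exists x g,
  [/\ U x, D = chamber_at B P V x, g \in unitmx &
      let A := g *m B *m g^T in let y := x *m invmx (intM R g) in
      [/\ forall i j, `|(A i j)%:~R : R| <= K,
          siegel (intM R A) N eps t.1.1.2 y,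
          code (invmx g *m ref A) t.1.2 &
          t.1.1.1 = map_mx (box M1) A /\ t.2 = sides y]].
apply: (finite_transversal (c := coded)
  (E := fun D D' => exists g, G g /\ D' = act g @` D)).
  move=> D [x [Ux ->]]; have /wall_complementP[Px _] := Ux.
  have [g [io [ug AK sy]]] := red x (positive_cone_gt0 lB posP Px Px).
  have [s cs] := codeE _ (isoref g ug).
  by exists (map_mx (box M1) (g *m B *m g^T), io, s, sides (x *m invmx (intM R g))), x, g.
move=> _ _ [[[a o] s] W] _ _ [x [g [Ux -> ug /= [AK sy cs [eA eW]]]]]
  [x' [g' [Ux' -> ug' /= [AK' sy' cs' [eA' eW']]]]].
have AA : g *m B *m g^T = g' *m B *m g'^T.
  apply/matrixP => i j; rewrite -(boxK (M1P _ (AK i j))) -(boxK (M1P _ (AK' i j))).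
  by move: eA; rewrite eA' => /matrixP/(_ i j); rewrite mxE [in RHS]mxE => ->.
have [|ur rA] := refP (g' *m B *m g'^T); first by exists g'.
(* Both bases share one reference basis, which cancels in the quotient of the two isometries. *)
have Gh : G (invmx g *m g').
  have -> : invmx g *m g' = invmx g *m ref (g *m B *m g^T) *m
      invmx (invmx g' *m ref (g' *m B *m g'^T)).
    apply: (can_inj (mulmxK (isoref g' ug').1)).
    by rewrite mulmxKV ?(isoref g' ug').1 // AA !mulmxA mulmxK.
  exact: (codeG _ _ s (isoref g' ug')).
exists (invmx g *m g'); split=> //.
rewrite (chamber_at_act finG GV x Gh).
have Ux1 := wall_complement_act finG GV Gh Ux.
set y := x *m invmx (intM R g) in sy eW; set y' := x' *m invmx (intM R g') in sy' eW'.
(* The group element keeps the coordinates y and exchanges the basis g for g', so both points can be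
   compared in the basis g'. *)
have x1E : act (invmx g *m g') x = y *m intM R g'.
  by rewrite /act -/(intM R (invmx g *m g')) intMM intM_inv // mulmxA.
have x'E : x' = y' *m intM R g' by rewrite /y' mulmxKV // intM_unit.
symmetry; apply: chamber_at_segment => t t01.
rewrite x1E in Ux1 *; rewrite x'E in Ux' *; rewrite AA in sy.
apply: (segment_in_complement lB posP Vd' Vc c0 N0 eps0 ceps M2P ug' AK' sy sy' Ux1 Ux' _ t01).
move=> w wM; have sidesE z : (map_mx (box M2) w \in sides z) = (0 < \sum_i z 0 i * (w 0 i)%:~R).
  by rewrite finset.in_set; congr (_ < _); apply: eq_bigr => i _; rewrite mxE boxK.
by rewrite -!sidesE -eW -eW'.
Qed.
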